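(* Let $G$ be an oligomorphic closed subgroup of $\mathrm{Sym}(\omega)$, and let $\mathcal N_G$ be its normaliser in $\mathrm{Sym}(\omega)$. (i) Let $S\colon\mathcal N_G\to\mathrm{Aut}(G)$ be the homomorphism defined by $S(\pi)(g)=\pi\circ g\circ\pi^{-1}$. The subgroup $\mathrm{range}(S)$ is open in $\mathrm{Aut}(G)$. (ii) $\mathrm{Out}(G)=\mathrm{Aut}(G)/\mathrm{Inn}(G)$ is totally disconnected and locally compact, having the profinite group $\mathcal P=\mathrm{range}(S)/\mathrm{Inn}(G)$ as an open subgroup. If $M_G$ is interdefinable with a structure in a finite signature, then $\mathcal P$ is finite, and hence $\mathrm{Out}(G)$ is discrete.
   Context: $\mathrm{Sym}(\omega)$ is the Polish group of permutations of $\omega$; a neighbourhood basis of $1$ is given by the pointwise stabilisers of finite sets. A subgroup $G\leq\mathrm{Sym}(\omega)$ is oligomorphic if for each $n$ the canonical action of $G$ on $\omega^n$ has only finitely many orbits. $\mathrm{Aut}(G)$ denotes the group of continuous automorphisms of $G$, with the (Polish) group topology for which a neighbourhood basis of the identity consists of the subgroups $\{\Phi: \Phi(A_i)=A_i \text{ for } i=1,\dots,n\}$, where $A_1,\dots,A_n$ are cosets of open subgroups of $G$. $\mathrm{Inn}(G)$ is the (closed) subgroup of inner automorphisms; quotients carry the quotient topology. $M_G$, the canonical structure for $G$, is the relational structure with domain $\omega$ that has, for each $n\geq1$ and each orbit of $G$ on $\omega^n$, an $n$-ary relation naming that orbit; it is $\aleph_0$-categorical and $G=\mathrm{Aut}(M_G)$.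 Two structures on the same domain are interdefinable if they have the same $\emptyset$-definable relations. *)

(* Defs.v *)
From HB Require Import structures.
From mathcomp Require Import all_boot all_classical.
From mathcomp Require Import topology.

Set Implicit Arguments.
Unset Strict Implicit.
Unset Printing Implicit Defensive.

Local Open Scope classical_set_scope.
Local Open Scope group_scope.
Local Open Scope quotient_scope.

(* A group and a topology on the same carrier, without any compatibility; the
   compatibility is the predicate [topological_group]. *)
#[short(type="groupTopType")]
HB.structure Definition GroupTop := {T of Group T & Topological T}.

Definition topological_group (T : groupTopType) : Prop :=
  continuous (fun p : T * T => p.1 * p.2) /\ continuous (fun x : T => x^-1).

Definition profinite (T : groupTopType) : Prop :=
  [/\ topological_group T, compact [set: T], hausdorff_space T
    & totally_disconnected [set: T]].

Definition discrete_space (T : topologicalType) : Prop :=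
  forall A : set T, open A.

(* The sets that are open for the topology of a group in which [B] is a
   neighbourhood basis of 1. *)
Definition open_of_basis1 (T : groupType) (B : set (set T)) (U : set T) : Prop :=
  forall x, U x -> exists2 V, B V & forall v, V v -> U (x * v).

Section OpenOfBasis1.
Variables (T : groupType) (B : set (set T)).
Hypothesis BT : B setT.
Hypothesis BI : setI_closed B.

Lemma open_of_basis1T : open_of_basis1 B setT.
Proof. by move=> x _; exists setT. Qed.

Lemma open_of_basis1I : setI_closed (open_of_basis1 B).
Proof.
move=> U U' oU oU' x [/oU[V BV VU] /oU'[V' BV' VU']].
by exists (V `&` V'); [exact: BI|move=> v [/VU ? /VU' ?]].
Qed.

Lemma open_of_basis1_bigU (I : Type) (f : I -> set T) :
  (forall i, open_of_basis1 B (f i)) -> open_of_basis1 B (\bigcup_i f i).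
Proof.
by move=> of_ x [i _ /of_[V BV Vf]]; exists V => // v /Vf ?; exists i.
Qed.

End OpenOfBasis1.

Record subgroup (T : groupType) := Subgroup {
  subgroup_set :> set T;
  subgroup_closed : group_closed (mem subgroup_set) }.

Section SubgroupTheory.
Variables (T : groupType) (H : subgroup T).
Local Notation inH := (subgroup_set H).

Lemma subgroup1 : inH 1.
Proof. by have [/set_mem] := subgroup_closed H. Qed.

Lemma subgroupF x y : inH x -> inH y -> inH (x / y).
Proof.
have [_ HF] := subgroup_closed H => Hx Hy.
by apply/set_mem/HF; exact/mem_set.
Qed.

Lemma subgroupV x : inH x -> inH x^-1.
Proof. by rewrite -[x^-1]mul1g; apply: subgroupF; exact: subgroup1. Qed.

Lemma subgroupM x y : inH x -> inH y -> inH (x * y).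
Proof. by move=> Hx /subgroupV Hy; rewrite -[y]invgK; exact: subgroupF. Qed.

End SubgroupTheory.

Lemma group_closed_set (T : groupType) (A : set T) :
  A 1 -> (forall x y, A x -> A y -> A (x / y)) -> group_closed (mem A).
Proof.
move=> A1 AF; split; first exact/mem_set.
by move=> x y /set_mem Ax /set_mem Ay; apply/mem_set/AF.
Qed.

HB.instance Definition _ (T : Type) (A : set T) :=
  [isSub of set_type A for sval].

HB.instance Definition _ (T : groupType) (H : subgroup T) :=
  SubChoice_isSubGroup.Build T _ (set_type H) (subgroup_closed H).

HB.instance Definition _ (T : groupTopType) (H : subgroup T) :=
  Topological.on (set_type H).

Record normal_subgroup (T : groupType) := NormalSubgroup {
  normal_set :> subgroup T;
  normal_conj : forall x y, subgroup_set normal_set x -> subgroup_set normal_set (x ^ y) }.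

Section Quotient.
Variables (T : groupTopType) (N : normal_subgroup T).

Definition coset_rel : rel T := [rel x y | `[< subgroup_set N (x^-1 * y) >]].

Lemma coset_rel_refl : reflexive coset_rel.
Proof. by move=> x; apply/asboolP; rewrite mulVg; exact: subgroup1. Qed.

Lemma coset_rel_sym : symmetric coset_rel.
Proof.
suff sub x y : coset_rel x y -> coset_rel y x by move=> x y; apply/idP/idP; exact: sub.
by move=> /asboolP/subgroupV; rewrite invgM invgK => ?; apply/asboolP.
Qed.

Lemma coset_rel_trans : transitive coset_rel.
Proof.
move=> y x z /asboolP Nxy /asboolP Nyz; apply/asboolP.
by have := subgroupM Nxy Nyz; rewrite -mulgA mulVKg.
Qed.

Canonical coset_equiv :=
  EquivRel coset_rel coset_rel_refl coset_rel_sym coset_rel_trans.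

Definition quotient : Type := quotient_topology {eq_quot coset_rel}.

HB.instance Definition _ := Topological.on quotient.
HB.instance Definition _ := Quotient.on quotient.

Lemma eq_quotient x y : (\pi_quotient x = \pi_quotient y) <-> subgroup_set N (x^-1 * y).
Proof.
by split=> [/eqmodP/asboolP|Nxy]; [|exact/eqmodP/asboolP].
Qed.

Definition quotient_one : quotient := \pi_quotient 1.
Definition quotient_mul (a b : quotient) : quotient := \pi_quotient (repr a * repr b).
Definition quotient_inv (a : quotient) : quotient := \pi_quotient (repr a)^-1.

Lemma piM x y : \pi_quotient (x * y) = quotient_mul (\pi x) (\pi y).
Proof.
rewrite /quotient_mul; apply/eq_quotient.
have Nx : subgroup_set N (x^-1 * repr (\pi_quotient x)) by apply/eq_quotient; rewrite reprK.
have Ny : subgroup_set N (y^-1 * repr (\pi_quotient y)) by apply/eq_quotient; rewrite reprK.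
move: (repr _) Nx (repr _) Ny => x' Nx y' Ny.
have := subgroupM (@normal_conj _ N _ y Nx) Ny.
by rewrite conjgE invgM !mulgA mulgK.
Qed.

Lemma piV x : \pi_quotient x^-1 = quotient_inv (\pi x).
Proof.
rewrite /quotient_inv; apply/eq_quotient.
have : subgroup_set N (x^-1 * repr (\pi_quotient x)) by apply/eq_quotient; rewrite reprK.
move: (repr _) => x' /subgroupV/(@normal_conj _ N _ x^-1).
by rewrite conjgE invgM !invgK !mulgA mulgK.
Qed.

Lemma quotient_mulA : associative quotient_mul.
Proof.
move=> a b c; rewrite -(reprK a) -(reprK b) -(reprK c).
by rewrite -(piM (repr b)) -(piM (repr a)) -(piM (repr a) (repr b)) -(piM (_ * _)) mulgA.
Qed.

Lemma quotient_mul1g : left_id quotient_one quotient_mul.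
Proof. by move=> a; rewrite -(reprK a) -(piM 1) mul1g. Qed.

Lemma quotient_mulg1 : right_id quotient_one quotient_mul.
Proof. by move=> a; rewrite -(reprK a) -(piM _ 1) mulg1. Qed.

Lemma quotient_mulVg : left_inverse quotient_one quotient_inv quotient_mul.
Proof. by move=> a; rewrite -(reprK a) -(piV (repr a)) -(piM _^-1) mulVg. Qed.

Lemma quotient_mulgV : right_inverse quotient_one quotient_inv quotient_mul.
Proof. by move=> a; rewrite -(reprK a) -(piV (repr a)) -(piM (repr a)) mulgV. Qed.

HB.instance Definition _ := isGroup.Build quotient quotient_mulA quotient_mul1g
  quotient_mulg1 quotient_mulVg quotient_mulgV.

Section Image.
Variable H : subgroup T.

Lemma quotient_image_closed : group_closed (mem ((\pi_quotient : T -> quotient) @` H)).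
Proof.
apply: group_closed_set; first by exists 1 => //; exact: subgroup1.
move=> _ _ [x Hx <-] [y Hy <-].
by exists (x / y); [exact: subgroupF|rewrite piM piV].
Qed.

(* The image of [H] in the quotient, that is H / N when N is contained in H. *)
Definition quotient_image : subgroup quotient := Subgroup quotient_image_closed.

End Image.
End Quotient.

Section InverseFunction.
Variables (T : Type) (f : T -> T).

Lemma bijective_inverse : bijective f -> exists g, cancel f g /\ cancel g f.
Proof. by case=> g fK gK; exists g. Qed.

Definition inverse_fun (bf : bijective f) := sval (cid (bijective_inverse bf)).

Lemma inverse_funK bf : cancel f (inverse_fun bf).
Proof. by rewrite /inverse_fun; case: cid => g []. Qed.

Lemma inverse_funVK bf : cancel (inverse_fun bf) f.
Proof. by rewrite /inverse_fun; case: cid => g []. Qed.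

Lemma inverse_fun_bij bf : bijective (inverse_fun bf).
Proof. exists f; [exact: inverse_funVK|exact: inverse_funK]. Qed.

End InverseFunction.

Record Sym := MkSym {
  sym_fun :> nat -> nat;
  sym_fun_bij : `[< bijective sym_fun >] }.

HB.instance Definition _ := [isSub for sym_fun].
HB.instance Definition _ := [Choice of Sym by <:].

Lemma sym_bij (g : Sym) : bijective g.
Proof. exact/asboolP/sym_fun_bij. Qed.

Lemma symP (g h : Sym) : g =1 h <-> g = h.
Proof. by split=> [/funext gh|->//]; exact: val_inj. Qed.

Definition sym_of (f : nat -> nat) (bf : bijective f) : Sym := MkSym (asboolT bf).

Definition sym_one : Sym := @sym_of id (Bijective (frefl _) (frefl _)).
Definition sym_mul (g h : Sym) : Sym := sym_of (bij_comp (sym_bij g) (sym_bij h)).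
Definition sym_inv (g : Sym) : Sym := sym_of (inverse_fun_bij (sym_bij g)).

Lemma sym_mulA : associative sym_mul. Proof. by move=> f g h; exact/symP. Qed.
Lemma sym_mul1g : left_id sym_one sym_mul. Proof. by move=> g; exact/symP. Qed.
Lemma sym_mulg1 : right_id sym_one sym_mul. Proof. by move=> g; exact/symP. Qed.
Lemma sym_mulVg : left_inverse sym_one sym_inv sym_mul.
Proof. by move=> g; apply/symP => i /=; rewrite inverse_funK. Qed.
Lemma sym_mulgV : right_inverse sym_one sym_inv sym_mul.
Proof. by move=> g; apply/symP => i /=; rewrite inverse_funVK. Qed.

HB.instance Definition _ :=
  isGroup.Build Sym sym_mulA sym_mul1g sym_mulg1 sym_mulVg sym_mulgV.

Definition pointwise_stabiliser (F : set nat) : set Sym :=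
  [set g | forall i, F i -> g i = i].

Definition Sym_basis : set (set Sym) :=
  [set pointwise_stabiliser F | F in [set F | finite_set F]].

Lemma Sym_basisT : Sym_basis setT.
Proof. by exists set0; [exact: finite_set0|apply/seteqP; split=> // g _ i]. Qed.

Lemma Sym_basisI : setI_closed Sym_basis.
Proof.
move=> _ _ [F finF <-] [F' finF' <-].
exists (F `|` F'); first by rewrite /= finite_setU.
rewrite eqEsubset; split=> [g gF|g [gF gF'] i [/gF|/gF']//].
by split=> i Fi; apply: gF; [left|right].
Qed.

HB.instance Definition _ := isOpenTopological.Build Sym
  (open_of_basis1T Sym_basisT) (open_of_basis1I Sym_basisI)
  (@open_of_basis1_bigU _ Sym_basis).

Record closed_subgroup := ClosedSubgroup {
  closed_subgroup_set :> subgroup Sym;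
  closed_subgroup_closed : closed (closed_subgroup_set : set Sym) }.

Definition orbit_of (G : set Sym) n (x : 'I_n -> nat) : set ('I_n -> nat) :=
  [set g \o x | g in G].

Definition orbits (G : set Sym) n : set (set ('I_n -> nat)) :=
  range (@orbit_of G n).

Arguments orbits G n : clear implicits.

Definition oligomorphic (G : set Sym) : Prop :=
  forall n, finite_set (orbits G n).

Section OpenMapping.
Variable G : closed_subgroup.
Implicit Types x y z u : G.

Definition agree n x y := forall i, i < n -> val x i = val y i.

(* Closeness for a complete metric: agreement alone has Cauchy sequences whose
   limit is not surjective. *)
Definition close n x y := agree n x y /\ agree n x^-1 y^-1.

Lemma valMg x y i : val (x * y) i = val x (val y i).
Proof. by []. Qed.

Lemma valKg x i : val x^-1 (val x i) = i.
Proof. by rewrite -valMg mulVg. Qed.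

Lemma valVKg x i : val x (val x^-1 i) = i.
Proof. by rewrite -valMg mulgV. Qed.

Lemma agreeW n m x y : n <= m -> agree m x y -> agree n x y.
Proof. by move=> nm xy i /leq_trans/(_ nm)/xy. Qed.

Lemma closeW n m x y : n <= m -> close m x y -> close n x y.
Proof. by move=> nm [? ?]; split; apply: agreeW nm _. Qed.

Lemma close_refl n x : close n x x. Proof. by []. Qed.

Lemma close_sym n x y : close n x y -> close n y x.
Proof. by case=> xy xyV; split=> i i_n; [rewrite xy|rewrite xyV]. Qed.

Lemma close_trans n y x z : close n x y -> close n y z -> close n x z.
Proof. by case=> xy xyV [yz yzV]; split=> i ?; [rewrite xy ?yz|rewrite xyV ?yzV]. Qed.

Lemma closeV n x y : close n x y -> close n x^-1 y^-1.
Proof. by case=> ? ?; split; rewrite ?invgK. Qed.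

Lemma bounded_fun (f : nat -> nat) n : exists m, forall i, i < n -> f i < m.
Proof.
by exists (\max_(i < n) (f i).+1) => i i_n; exact: (leq_bigmax (Ordinal i_n)).
Qed.

Lemma Sym_openP (U : set Sym) : open U <->
  forall p, U p -> exists n, forall q : Sym, (forall i, i < n -> q i = p i) -> U q.
Proof.
rewrite (_ : open U = open_of_basis1 Sym_basis U) //.
split=> [oU p /oU[_ [F /finite_seqP[X ->] <-] pXU]|H p /H[n nU]].
  exists (\max_(i <- X) i.+1) => q qp.
  rewrite -[q](mulVKg p); apply: pXU => i Xi.
  rewrite (_ : (p^-1 * q) i = p^-1 (q i)) // qp; last first.
    by rewrite (big_rem i Xi) /= leq_max leqnn.
  by rewrite (_ : p^-1 (p i) = (p^-1 * p) i) // mulVg.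
exists (pointwise_stabiliser `I_n); first by exists `I_n => //; exact: finite_II.
by move=> v vn; apply: nU => i i_n; rewrite (_ : (p * v) i = p (v i)) // vn.
Qed.

Lemma G_openP (U : set G) : open U <->
  forall x, U x -> exists n, forall y, agree n y x -> U y.
Proof.
split=> [[V /Sym_openP oV <-] x /oV[n nV]|H].
  by exists n => y yx; exact: nV.
exists [set p : Sym | exists2 x, U x & exists n, (forall y, agree n y x -> U y) /\
          forall i, i < n -> p i = val x i].
  apply/Sym_openP => p [x Ux [n [nU px]]]; exists n => q qp.
  by exists x => //; exists n; split=> // i i_n; rewrite qp ?px.
apply/seteqP; split=> [y [x Ux [n [nU yx]]]|x Ux]; first exact: nU.
by have [n nU] := H _ Ux; exists x => //; exists n.
Qed.

Lemma continuousGP (f : G -> G) : continuous f <->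
  forall x n, exists m, forall y, agree m y x -> agree n (f y) (f x).
Proof.
split=> [/continuousP cf x n|H].
  have /G_openP/(_ x)[//|m mH] : open (f @^-1` [set y | agree n y (f x)]).
    apply: cf; apply/G_openP => y yfx; exists n => z zy i i_n.
    by rewrite zy ?yfx.
  by exists m.
apply/continuousP => A /G_openP oA; apply/G_openP => x /oA[n nA].
by have [m mf] := H x n; exists m => y /mf/nA.
Qed.

Lemma close_mull z n : exists m, forall x y, close m x y -> close n (z * x) (z * y).
Proof.
have [m mz] := bounded_fun (val z^-1) n.
exists (maxn n m) => x y [xy xyV]; split=> i i_n.
  by rewrite !valMg xy // leq_max i_n.
by rewrite !invgM !valMg xyV // leq_max mz ?orbT.
Qed.

Lemma close_mulr z n : exists m, forall x y, close m x y -> close n (x * z) (y * z).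
Proof.
have [m mz] := close_mull z^-1 n.
exists m => x y /closeV/mz/closeV; by rewrite !invgM !invgK.
Qed.

Lemma agree1_close n x : agree n x 1 -> close n x 1.
Proof.
move=> x1; split=> // i i_n; rewrite invg1.
by rewrite -[in LHS](x1 i i_n : val x i = i) valKg.
Qed.

Lemma close1M n x y : close n x 1 -> close n y 1 -> close n (x * y) 1.
Proof.
move=> [x1 _] [y1 _]; apply: agree1_close => i i_n.
by rewrite valMg (y1 i i_n : _ = i) x1.
Qed.

Lemma close1V n x : close n x 1 -> close n x^-1 1.
Proof. by move=> /closeV; rewrite invg1. Qed.

Lemma close_limit (a : nat -> G) : (forall k, close k (a k) (a k.+1)) ->
  exists x, forall k, close k (a k) x.
Proof.
move=> aS.
have aD k d : close k (a k) (a (k + d)).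
  elim: d => [|d IH]; first by rewrite addn0.
  by apply: close_trans IH _; rewrite addnS; apply: closeW (aS _); exact: leq_addr.
have aW k l : k <= l -> close k (a k) (a l) by move=> /subnKC <-.
pose f i := val (a i.+1) i; pose g i := val (a i.+1)^-1 i.
have fE k i : i < k -> f i = val (a k) i by move=> ik; rewrite /f; have [->] := aW _ _ ik.
have gE k i : i < k -> g i = val (a k)^-1 i by move=> ik; rewrite /g; have [_ ->] := aW _ _ ik.
have fK : cancel f g.
  move=> i; pose k := maxn i.+1 (f i).+1.
  by rewrite (gE k) ?leq_max ?leqnn ?orbT // (fE k) ?leq_max ?leqnn // valKg.
have gK : cancel g f.
  move=> i; pose k := maxn i.+1 (g i).+1.
  by rewrite (fE k) ?leq_max ?leqnn ?orbT // (gE k) ?leq_max ?leqnn // valVKg.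
pose p := sym_of (Bijective fK gK).
have Gp : (G : set Sym) p.
  rewrite [X in X p](iffLR (closure_id _) (closed_subgroup_closed (c := G))).
  move=> U; rewrite nbhsE => -[V [/Sym_openP oV Vp] VU].
  have [n nV] := oV _ Vp; exists (val (a n)); split; first exact/set_mem/(valP (a n)).
  by apply/VU/nV => i i_n; rewrite -fE.
exists (exist _ p (mem_set Gp) : G) => k; split=> i i_k; first by rewrite -fE.
rewrite -(gE k) // -[in RHS](gK i).
by rewrite -[f _](_ : val (exist _ p (mem_set Gp) : G) (g i) = _) // valKg.
Qed.

Lemma dependent_choice (T : Type) (P : nat -> T -> Prop) (R : nat -> T -> T -> Prop) t0 :
  P 0 t0 -> (forall k t, P k t -> exists2 t', P k.+1 t' & R k t t') ->
  exists t : nat -> T, [/\ t 0 = t0, forall k, P k (t k) & forall k, R k (t k) (t k.+1)].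
Proof.
move=> P0 PS.
have /choice[F FP] (kt : nat * T) : exists t', P kt.1 kt.2 -> P kt.1.+1 t' /\ R kt.1 kt.2 t'.
  case: kt => k t /=; have [/PS[t' ? ?]|nP] := pselect (P k t); first by exists t'.
  by exists t.
pose t := fix t k := if k is k'.+1 then F (k', t k') else t0.
have Pt k : P k (t k) by elim: k => //= k /(FP (k, t k))[].
by exists t; split=> // k; have [] := FP (k, t k) (Pt k).
Qed.

Lemma countable_cosets n : exists e : nat -> G, forall x, exists i, close n ((e i)^-1 * x) 1.
Proof.
have /choice[e eP] (i : nat) : exists z, forall x,
    pickle [seq val x i | i <- iota 0 n] = i -> agree n z x.
  have [[z zi]|nex] := pselect (exists z, pickle [seq val z i | i <- iota 0 n] = i).
    exists z => x xi j j_n.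
    have /(pcan_inj pickleK)/eq_in_map : pickle [seq val z i | i <- iota 0 n] =
      pickle [seq val x i | i <- iota 0 n] by rewrite zi xi.
    by apply; rewrite mem_iota.
  by exists 1 => x xi; case: nex; exists x.
exists e => x; exists (pickle [seq val x i | i <- iota 0 n]).
apply: agree1_close => j j_n; rewrite valMg -(eP _ x erefl j j_n).
by rewrite valKg.
Qed.

Section Hom.
Variable f : G -> G.
Hypothesis fM : {morph f : x y / x * y}.
Hypothesis f_cont : continuous f.
Hypothesis f_surj : forall y, exists x, f x = y.

Lemma hom1 : f 1 = 1.
Proof. by apply: (@mulgI _ (f 1)); rewrite -fM !mulg1. Qed.

Lemma homV x : f x^-1 = (f x)^-1.
Proof. by apply: (@mulgI _ (f x)); rewrite -fM !mulgV hom1. Qed.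

(* [y] lies in the closure of the image of the stabiliser of {0, ..., n - 1}. *)
Definition cl_image n (y : G) : Prop :=
  forall k, exists2 x, close n x 1 & close k (f x) y.

Lemma cl_image1 n : cl_image n 1.
Proof. by move=> k; exists 1 => //; rewrite hom1. Qed.

Lemma cl_imageM n x y : cl_image n x -> cl_image n y -> cl_image n (x * y).
Proof.
move=> cx cy k.
have [m mx] := close_mull x k; have [y' y'1 /mx xy] := cy m.
have [l ly] := close_mulr (f y') k; have [x' x'1 /ly xx] := cx l.
by exists (x' * y'); [exact: close1M|rewrite fM; exact: close_trans xx xy].
Qed.

(* By Baire category: countably many translates of the image cover [G]. *)
Lemma cl_image_nbhs n : exists m, forall y, close m y 1 -> cl_image n y.
Proof.
apply: contrapT => nex; have [e eP] := countable_cosets n.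
pose D i := [set y : G | exists2 x, close n x 1 & y = f (e i * x)].
have nowhere_dense i z k : exists z' k',
    [/\ close k z z', k <= k' & forall y, D i y -> ~ close k' y z'].
  apply: contrapT => H; apply: nex.
  have dense z' : close k z z' -> forall k', exists2 y, D i y & close k' y z'.
    move=> zz' k'; apply: contrapT => H'; apply: H; exists z', (maxn k k').
    split=> //; first exact: leq_maxl.
    by move=> y Dy c; apply: H'; exists y => //; apply: closeW c; exact: leq_maxr.
  have [_ [x0 x01 ->] cl] := dense z (close_refl k z) k.
  have [m my0] := close_mull (f (e i * x0)) k; exists m => u u1 l.
  have zu : close k z (f (e i * x0) * u).
    apply: close_trans (close_sym cl) _; rewrite -[X in close _ X _]mulg1.
    exact/my0/close_sym.
  have [l' l'P] := close_mull (f (e i * x0))^-1 l.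
  have [_ [x x1 ->] /l'P] := dense _ zu l'.
  rewrite mulKg -homV -fM invgM mulgA mulgVK => fu.
  by exists (x0^-1 * x) => //; apply: close1M => //; exact: close1V.
pose P k (t : G * nat) := k <= t.2.
pose R k (t t' : G * nat) := [/\ close t.2 t.1 t'.1, t.2 <= t'.2
   & forall y, D k y -> ~ close t'.2 y t'.1].
have [//|k [z l]/= kl|t [_ Pt Rt]] := @dependent_choice _ P R (1, 0).
  have {}kl : k <= l := kl.
  have [z' [l' [zz' ll' zD]]] := nowhere_dense k z l.
  exists (z', maxn l' l.+1); first by rewrite /P/= leq_max ltnS kl orbT.
  split=> //=; first by rewrite leq_max leqnSn orbT.
  by move=> y /zD yz c; apply: yz; apply: closeW c; exact: leq_maxl.
have tW k d : close (t k).2 (t k).1 (t (k + d)).1 /\ (t k).2 <= (t (k + d)).2.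
  elim: d => [|d [IH1 IH2]]; first by rewrite addn0.
  rewrite addnS; have [c le _] := Rt (k + d); split; last exact: leq_trans le.
  by apply: close_trans IH1 _; apply: closeW c.
have [k|z zP] := @close_limit (fun k => (t k).1).
  by have [c _ _] := Rt k; apply: closeW c; exact: Pt.
have [x xz] := f_surj z; have [i xi] := eP x.
have [_ _ /(_ z)] := Rt i; apply.
  by exists ((e i)^-1 * x) => //; rewrite mulVKg.
apply: close_sym; have [c _] := tW i.+1 (t i.+1).2; apply: close_trans c _.
by apply: closeW (zP _); exact: leq_addl.
Qed.

Lemma cl_image_open n y : cl_image n y ->
  exists m, forall z, close m z y -> cl_image n z.
Proof.
move=> cy; have [m mP] := cl_image_nbhs n.
have [l lP] := close_mull y^-1 m; exists l => z /lP; rewrite mulVg => /mP.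
by rewrite -[X in _ -> cl_image _ X](mulVKg y z); exact: cl_imageM.
Qed.

Lemma cl_image_dense p k z m : cl_image k ((f p)^-1 * z) ->
  exists2 u, close k u 1 & close m (f (p * u)) z.
Proof.
move=> cz; have [l lP] := close_mull (f p) m.
by have [u u1 /lP] := cz l; rewrite mulVKg -fM; exists u.
Qed.

Definition controls j p k := forall u, close k u 1 ->
  close j (p * u) p /\ agree j (f (p * u)) (f p).

Lemma exists_controls j p n : exists2 k, n <= k & controls j p k.
Proof.
have [k1 k1P] := close_mull p j.
have [k2 k2P] := (continuousGP f).1 f_cont p j.
have [k3 k3P] := close_mull p k2.
exists (maxn n (maxn k1 k3)); first exact: leq_maxl.
move=> u u1; split.
  have := k1P u 1; rewrite mulg1; apply.
  by apply: closeW u1; rewrite !leq_max leqnn orbT.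
apply: k2P; have := k3P u 1; rewrite mulg1 => -[]//.
by apply: closeW u1; rewrite !leq_max leqnn !orbT.
Qed.

Lemma hom_open n : exists m, forall y, close m y 1 ->
  exists2 x, close n x 1 & f x = y.
Proof.
have [m mP] := cl_image_nbhs n; exists m => y /mP cy.
pose half j (p : G) k := [/\ close n p 1, n <= k & controls j p k].
pose meet (p : G) k (q : G) l :=
  exists2 z, cl_image k ((f p)^-1 * z) & cl_image l ((f q)^-1 * (y^-1 * z)).
pose P j (t : (G * nat) * (G * nat)) := [/\ half j t.1.1 t.1.2,
  half j t.2.1 t.2.2 & meet t.1.1 t.1.2 t.2.1 t.2.2].
pose R j (t t' : (G * nat) * (G * nat)) :=
  close j t.1.1 t'.1.1 /\ close j t.2.1 t'.2.1.
have half_step j p k u : half j p k -> close k u 1 ->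
    exists2 k', half j.+1 (p * u) k' & close j p (p * u).
  move=> [p1 nk c] u1; have [k' nk' c'] := exists_controls j.+1 (p * u) n.
  exists k'; last by have [/close_sym] := c _ u1.
  by split=> //; apply: close1M => //; exact: closeW u1.
have [||t [_ Pt Rt]] := @dependent_choice _ P R ((1, n), (1, n)).
- split=> //; exists y; rewrite hom1 invg1 mul1g // mulVg; exact: cl_image1.
- move=> j [[p k] [q l]] [/= hp hq [z cp cq]].
  have [r rP] := cl_image_open cq.
  have [r' r'P] := close_mull y^-1 r; have [r'' r''P] := close_mull (f q)^-1 r'.
  have [s sP] := close_mull (f q)^-1 r; have [s' s'P] := close_mull y^-1 s.
  have [u u1 /s'P/sP/rP cq'] := cl_image_dense s' cp.
  have [k' hp' pp'] := half_step _ _ _ _ hp u1.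
  have cp' : cl_image k' ((f (p * u))^-1 * f (p * u)).
    by rewrite mulVg; exact: cl_image1.
  have [a aP] := cl_image_open cp'.
  have [b bP] := close_mull (f (p * u))^-1 a; have [c cP] := close_mull y b.
  have [v v1 /cP] := cl_image_dense c cq'.
  rewrite mulVKg => /bP/aP cp''.
  have [l' hq' qq'] := half_step _ _ _ _ hq v1.
  exists ((p * u, k'), (q * v, l')); last by split.
  split=> //; exists (y * f (q * v)) => //.
  by rewrite mulKg mulVg; exact: cl_image1.
have [k|p pP] := @close_limit (fun k => (t k).1.1); first by have [] := Rt k.
have [k|q qP] := @close_limit (fun k => (t k).2.1); first by have [] := Rt k.
have p1 : close n p 1.
  by have [[? _ _] _ _] := Pt n; apply: close_trans (close_sym (pP n)) _.
have q1 : close n q 1.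
  by have [_ [? _ _] _] := Pt n; apply: close_trans (close_sym (qP n)) _.
exists (p / q); first by apply: close1M => //; exact: close1V.
suff fpq : f p = y * f q by rewrite fM homV fpq mulgK.
apply/val_inj/symP => i.
have [a aP] := (continuousGP f).1 f_cont p i.+1.
have [b bP] := (continuousGP f).1 f_cont q i.+1.
pose j := maxn i.+1 (maxn a b).
have ij : i < j by rewrite leq_max leqnn.
have [[_ _ hp] [_ _ hq] [z cp cq]] := Pt j.
have [u u1 [uz _]] := cl_image_dense j cp.
have [v v1 [vz _]] := cl_image_dense j cq.
have zp : val z i = val (f p) i.
  rewrite -uz // (hp _ u1).2 // (aP (t j).1.1) //.
  by apply: agreeW (pP j).1; rewrite !leq_max leqnn orbT.
have zq : val (y^-1 * z) i = val (f q) i.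
  rewrite -vz // (hq _ v1).2 // (bP (t j).2.1) //.
  by apply: agreeW (qP j).1; rewrite !leq_max leqnn !orbT.
by rewrite -zp valMg -zq valMg valVKg.
Qed.

End Hom.

Lemma can2_gmulfM_fun (f f' : G -> G) : cancel f f' -> cancel f' f ->
  {morph f : x y / x * y} -> {morph f' : x y / x * y}.
Proof. by move=> fK f'K fM x y; apply: (canLR fK); rewrite fM !f'K. Qed.

Lemma inverse_hom_continuous (f f' : G -> G) : {morph f : x y / x * y} ->
  continuous f -> cancel f f' -> cancel f' f -> continuous f'.
Proof.
move=> fM cf fK f'K; apply/continuousGP => x n.
have f_surj y : exists x, f x = y by exists (f' y).
have [m mP] := hom_open fM cf f_surj n; exists m => y yx.
have [v [v1 _] fv] : exists2 v, close n v 1 & f v = x^-1 * y.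
  by apply/mP/agree1_close => i i_m; rewrite valMg yx // valKg.
have -> : f' y = f' x * v by apply: (canLR fK); rewrite fM f'K fv mulVKg.
by move=> i i_n; rewrite valMg (v1 i i_n : _ = i).
Qed.

End OpenMapping.

Section Automorphisms.
Variable G : closed_subgroup.

Definition is_continuous_automorphism (f : G -> G) : Prop :=
  [/\ {morph f : x y / x * y}, bijective f & continuous f].

(* Only the continuity of the map itself is required; that of the inverse follows
   by [inverse_hom_continuous]. *)
Record Aut := MkAut {
  aut_fun :> G -> G;
  aut_funP : `[< is_continuous_automorphism aut_fun >] }.

HB.instance Definition _ := [isSub for aut_fun].
HB.instance Definition _ := [Choice of Aut by <:].

Implicit Types f g : Aut.

Lemma autM f : {morph f : x y / x * y}.
Proof. by have /asboolP[] := aut_funP f. Qed.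

Lemma aut_bij f : bijective f.
Proof. by have /asboolP[] := aut_funP f. Qed.

Lemma aut_continuous f : continuous f.
Proof. by have /asboolP[] := aut_funP f. Qed.

Lemma aut1 f : f 1 = 1.
Proof. by apply: (@mulgI _ (f 1)); rewrite -autM !mulg1. Qed.

Lemma autV f x : f x^-1 = (f x)^-1.
Proof. by apply: (@mulgI _ (f x)); rewrite -autM !mulgV aut1. Qed.

Lemma autP f g : f =1 g <-> f = g.
Proof. by split=> [/funext fg|->//]; exact: val_inj. Qed.

Lemma aut_one_subproof : is_continuous_automorphism id.
Proof. by split=> //; [exists id|move=> x; exact: cvg_id]. Qed.

Lemma aut_mul_subproof f g : is_continuous_automorphism (f \o g).
Proof.
split; first by move=> x y /=; rewrite !autM.
- exact: bij_comp (aut_bij f) (aut_bij g).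
- by move=> x; apply: continuous_comp; exact: aut_continuous.
Qed.

Lemma aut_inv_subproof f : is_continuous_automorphism (inverse_fun (aut_bij f)).
Proof.
split.
- exact: can2_gmulfM_fun (inverse_funK _) (inverse_funVK _) (autM f).
- exact: inverse_fun_bij.
- exact: inverse_hom_continuous (autM f) (@aut_continuous f)
    (inverse_funK _) (inverse_funVK _).
Qed.

Definition aut_one : Aut := MkAut (asboolT aut_one_subproof).
Definition aut_mul f g : Aut := MkAut (asboolT (aut_mul_subproof f g)).
Definition aut_inv f : Aut := MkAut (asboolT (aut_inv_subproof f)).

Lemma aut_mulA : associative aut_mul. Proof. by move=> f g h; exact/autP. Qed.
Lemma aut_mul1g : left_id aut_one aut_mul. Proof. by move=> f; exact/autP. Qed.
Lemma aut_mulg1 : right_id aut_one aut_mul. Proof. by move=> f; exact/autP. Qed.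
Lemma aut_mulVg : left_inverse aut_one aut_inv aut_mul.
Proof. by move=> f; apply/autP => x /=; rewrite inverse_funK. Qed.
Lemma aut_mulgV : right_inverse aut_one aut_inv aut_mul.
Proof. by move=> f; apply/autP => x /=; rewrite inverse_funVK. Qed.

HB.instance Definition _ :=
  isGroup.Build Aut aut_mulA aut_mul1g aut_mulg1 aut_mulVg aut_mulgV.

(* Left cosets suffice: the right coset of [H] by [x] is the left coset by [x]
   of [x^-1 H x]. *)
Definition open_coset (A : set G) : Prop :=
  exists (H : subgroup G) (x : G), open (H : set G) /\ A = [set x * h | h in H].

Definition setwise_stabiliser (C : set (set G)) : set Aut :=
  [set f | forall A, C A -> f @` A = A].

Definition Aut_basis : set (set Aut) :=
  [set setwise_stabiliser C | C in [set C | finite_set C /\ C `<=` open_coset]].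

Lemma Aut_basisT : Aut_basis setT.
Proof.
exists set0; last by apply/seteqP; split=> // f _ A.
by split; [exact: finite_set0|exact: sub0set].
Qed.

Lemma Aut_basisI : setI_closed Aut_basis.
Proof.
move=> _ _ [C [finC openC] <-] [D [finD openD] <-]; exists (C `|` D).
  by split; [rewrite finite_setU|move=> A [/openC|/openD]].
rewrite eqEsubset; split=> [f fCD|f [fC fD] A [/fC|/fD]//].
by split=> A CA; apply: fCD; [left|right].
Qed.

HB.instance Definition _ := isOpenTopological.Build Aut
  (open_of_basis1T Aut_basisT) (open_of_basis1I Aut_basisI)
  (@open_of_basis1_bigU _ Aut_basis).

Definition Inn_set : set Aut :=
  [set f | exists g : G, forall x, f x = g * x * g^-1].

Lemma Inn_closed : group_closed (mem Inn_set).
Proof.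
apply: group_closed_set; first by exists 1 => x; rewrite mul1g invg1 mulg1.
move=> f f' [g fE] [g' f'E]; exists (g * g'^-1) => x.
rewrite (_ : (f / f') x = f (f'^-1 x)) // fE.
have -> : f'^-1 x = g'^-1 * x * g'.
  apply: (bij_inj (aut_bij f')); rewrite [RHS]f'E !mulgA mulgV mul1g mulgK.
  by rewrite (_ : f' (f'^-1 x) = (f' * f'^-1) x) // mulgV.
by rewrite invgM invgK !mulgA.
Qed.

Lemma Inn_conj (f g : Aut) :
  Inn_set f -> Inn_set (f ^ g).
Proof.
move=> [a fE]; exists (g^-1 a) => x.
rewrite (_ : (f ^ g) x = g^-1 (f (g x))) // fE !autM.
have gK y : g^-1 (g y) = y.
  by rewrite (_ : g^-1 (g y) = (g^-1 * g) y) // mulVg.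
by rewrite gK autV.
Qed.

Definition Inn : normal_subgroup Aut :=
  @NormalSubgroup _ (Subgroup Inn_closed) Inn_conj.

Definition Out : Type := quotient Inn.

HB.instance Definition _ := GroupTop.on Out.

Definition normaliser_set : set Sym :=
  [set p | [set p * g * p^-1 | g in (G : set Sym)] = G].

Lemma normaliser_set_conj (p g : Sym) :
  normaliser_set p -> (G : set Sym) (p * g * p^-1) <-> (G : set Sym) g.
Proof.
move=> pG; split=> [|Gg]; last by rewrite -pG; exists g.
by rewrite -[X in X _ -> _]pG => -[h Gh /mulIg/mulgI <-].
Qed.

Lemma normaliser_setP (p : Sym) :
  (forall g : Sym, (G : set Sym) (p * g * p^-1) <-> (G : set Sym) g) ->
  normaliser_set p.
Proof.
move=> pG; rewrite /normaliser_set /= eqEsubset; split=> [_ [g Gg <-]|g Gg].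
  exact/pG.
exists (p^-1 * g * p); last by rewrite !mulgA mulgK mulgV mul1g.
by apply/pG; rewrite !mulgA mulgK mulgV mul1g.
Qed.

Lemma normaliser_closed : group_closed (mem normaliser_set).
Proof.
apply: group_closed_set; first by apply: normaliser_setP => g; rewrite mul1g invg1 mulg1.
move=> p q Np Nq; apply: normaliser_setP => g.
have -> : p / q * g * (p / q)^-1 = p * (q^-1 * g * q) * p^-1.
  by rewrite invgM invgK !mulgA.
rewrite normaliser_set_conj // -(normaliser_set_conj (q^-1 * g * q) Nq).
by rewrite !mulgA mulgK mulgV mul1g.
Qed.

Definition normaliser : subgroup Sym := Subgroup normaliser_closed.

Lemma conj_in_subproof (p : normaliser) (g : G) :
  val p * val g * (val p)^-1 \in (G : set Sym).
Proof.
by apply/mem_set/normaliser_set_conj; apply/set_mem; [exact: valP p|exact: valP g].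
Qed.

Definition conj_fun (p : normaliser) (g : G) : G :=
  exist (fun x => x \in (G : set Sym)) _ (conj_in_subproof p g).

Lemma conj_funP (p : normaliser) : is_continuous_automorphism (conj_fun p).
Proof.
have conjK q : cancel (conj_fun q) (conj_fun q^-1).
  move=> g; apply: val_inj => /=.
  by rewrite invgK !mulgA mulVg mul1g mulgVK.
split.
- by move=> g h; apply: val_inj => /=; rewrite !mulgA mulgVK.
- by exists (conj_fun p^-1) => //; have := conjK p^-1; rewrite invgK.
apply/continuousGP => g n; have [m mP] := bounded_fun ((val p)^-1 : Sym)%g n.
exists m => h hg i i_n.
rewrite (_ : val (conj_fun p h) i = val p (val h ((val p)^-1 i))) //.
by rewrite hg //; exact: mP.
Qed.

Definition conj_hom (p : normaliser) : Aut := MkAut (asboolT (conj_funP p)).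

Lemma conj_homM : {morph conj_hom : p q / p * q}.
Proof.
move=> p q; apply/autP => g; apply: val_inj => /=.
by rewrite invgM !mulgA.
Qed.

HB.instance Definition _ := isMultiplicative.Build _ _ conj_hom conj_homM.

Lemma range_conj_hom_closed : group_closed (mem (range conj_hom)).
Proof.
apply: group_closed_set.
  exists 1 => //; apply/autP => g; apply: val_inj => /=.
  by rewrite invg1 mulg1 mul1g.
move=> _ _ [p _ <-] [q _ <-]; exists (p / q) => //.
by apply: (@mulIg _ (conj_hom q)); rewrite -conj_homM !mulgVK.
Qed.

Definition range_conj_hom : subgroup Aut := Subgroup range_conj_hom_closed.

Lemma Inn_sub_range_conj_hom : (Inn : set Aut) `<=` range conj_hom.
Proof.
move=> f [g fE].
have Ng : val g \in normaliser_set.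
  apply/mem_set/normaliser_setP => h; have Gg : subgroup_set G (val g) by exact/set_mem/(valP g).
  split=> [|Gh]; last by apply: subgroupM; [exact: subgroupM|exact: subgroupV].
  by move=> /(subgroupM (subgroupV Gg))/subgroupM/(_ Gg); rewrite !mulgA mulVg mul1g mulgVK.
exists (exist (fun p => p \in normaliser_set) _ Ng) => //.
by apply/autP => x; apply: val_inj; rewrite fE.
Qed.

(* The group range(S) / Inn(G), as a subgroup of Out(G). *)
Definition range_mod_Inn : subgroup Out := quotient_image Inn range_conj_hom.

End Automorphisms.

Record signature := Signature {
  fsym : Type; farity : fsym -> nat;
  rsym : Type; rarity : rsym -> nat }.

Definition finite_signature (L : signature) : Prop :=
  finite_set [set: fsym L] /\ finite_set [set: rsym L].

Record structure (L : signature) (D : Type) := Structure {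
  finterp : forall s : fsym L, ('I_(farity s) -> D) -> D;
  rinterp : forall r : rsym L, set ('I_(rarity r) -> D) }.

(* The free variables of a term or formula of index [n] are among 'I_n; [All]
   binds variable 0 and shifts the other ones. *)
Inductive term (L : signature) (n : nat) : Type :=
| Var of 'I_n
| App (s : fsym L) of ('I_(farity s) -> term L n).

Inductive formula (L : signature) : nat -> Type :=
| Bot n : formula L n
| Equal n of term L n & term L n : formula L n
| Rel n (r : rsym L) of ('I_(rarity r) -> term L n) : formula L n
| Imp n of formula L n & formula L n : formula L n
| All n of formula L n.+1 : formula L n.

Section Semantics.
Variables (L : signature) (D : Type) (M : structure L D).

Fixpoint eval n (v : 'I_n -> D) (t : term L n) : D :=
  match t with
  | Var i => v i
  | App s ts => finterp M (fun i => eval v (ts i))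
  end.

Definition extend n (a : D) (v : 'I_n -> D) (i : 'I_n.+1) : D :=
  oapp v a (unlift ord0 i).

Fixpoint sat n (phi : formula L n) : ('I_n -> D) -> Prop :=
  match phi with
  | Bot _ => fun=> False
  | Equal _ t u => fun v => eval v t = eval v u
  | Rel _ r ts => fun v => rinterp M (fun i => eval v (ts i))
  | Imp _ phi1 phi2 => fun v => sat phi1 v -> sat phi2 v
  | All _ phi1 => fun v => forall a, sat phi1 (extend a v)
  end.

Definition definable n (R : set ('I_n -> D)) : Prop :=
  exists phi : formula L n, R = [set v | sat phi v].

End Semantics.

Definition interdefinable (D : Type) (L L' : signature)
    (M : structure L D) (M' : structure L' D) : Prop :=
  forall n (R : set ('I_n -> D)), definable M R <-> definable M' R.

Record orbit_symbol (G : set Sym) := OrbitSymbol {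
  symbol_arity : nat;
  symbol_arity_gt0 : 0 < symbol_arity;
  symbol_orbit : set ('I_symbol_arity -> nat);
  symbol_orbitP : orbits G symbol_arity symbol_orbit }.

Definition orbit_signature (G : set Sym) : signature :=
  @Signature void (fun _ => 0) (orbit_symbol G) (@symbol_arity G).

Definition canonical_structure (G : set Sym) : structure (orbit_signature G) nat :=
  @Structure (orbit_signature G) nat (fun s => match s with end) (@symbol_orbit G).

(* Main.v *)
Require Import Defs.
From mathcomp Require Import all_boot all_classical.
From mathcomp Require Import topology.

(* For each finite set of points there is a basic neighbourhood of 1 in
   Aut(G) all of whose members are conjugations by permutations fixing these
   points: an automorphism f that stabilises the point stabilisers of
   representatives b of the orbits of G on omega is conjugation by the
   permutation g b |-> f(g) b. Hence range(S) is open. The members of the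
   basis of neighbourhoods of 1 are subgroups, so that their cosets are
   clopen, and likewise in Out(G). It remains to see that Inn(G) is closed
   in Aut(G), which follows from the finiteness of the centraliser of G in
   Sym(omega), and that range(S)/Inn(G) is compact. An element of the
   normaliser permutes the finitely many orbits of G on omega^n, for each n;
   an ultrafilter on the normaliser selects a permutation of the orbits for
   all n simultaneously, and a back-and-forth construction realises it by an
   element of the normaliser, whose class is the limit. With a finite
   signature, the action on the orbits of one suitable omega^n determines an
   element of the normaliser modulo G. *)

Set Implicit Arguments.
Unset Strict Implicit.
Unset Printing Implicit Defensive.

Local Open Scope classical_set_scope.
Local Open Scope group_scope.
Local Open Scope quotient_scope.

(** * Topological groups with a basis of open subgroups *)

(** The third clause weakens normality: it asks that conjugation by each fixed element be continuous
    at 1. *)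
Definition linear_basis1 (T : groupTopType) (B : set (set T)) : Prop :=
  [/\ forall U : set T, open U <-> open_of_basis1 B U,
      forall V, B V -> V 1 /\ (forall x y, V x -> V y -> V (x / y))
    & forall V x, B V -> exists2 W, B W & forall w, W w -> V (w ^ x)].

Section LinearBasis.
Variables (T : groupTopType) (B : set (set T)).
Hypothesis linB : linear_basis1 B.

Lemma linear_basis1_open_coset V x : B V -> open [set y | V (x^-1 * y)].
Proof.
case: linB => oB sB _ BV; apply/oB => y Vy; exists V => // v Vv.
have [V1 VF] := sB _ BV; rewrite /= mulgA -[v]invgK.
by apply: (VF) => //; rewrite -[v^-1]mul1g; exact: VF.
Qed.

Lemma linear_basis1_closed_coset V x : B V -> closed [set y | V (x^-1 * y)].
Proof.
case: linB => oB sB _ BV; rewrite -openC; apply/oB => y nVy; exists V => // v Vv Vyv.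
have [V1 VF] := sB _ BV; apply: nVy.
by have := VF _ _ Vyv Vv; rewrite mulgA mulgK.
Qed.

Lemma linear_basis1_nbhs x (U : set T) :
  nbhs x U <-> exists2 V, B V & forall v, V v -> U (x * v).
Proof.
split.
  case: linB => oB _ _.
  rewrite nbhsE => -[O [/oB oO Ox] OU]; have [V BV VO] := oO _ Ox.
  by exists V => // v /VO/OU.
case=> V BV VU; rewrite nbhsE; exists [set y | V (x^-1 * y)].
  split; first exact: linear_basis1_open_coset.
  by rewrite /= mulVg; case: linB => _ sB _; have [] := sB _ BV.
by move=> y /VU; rewrite mulVKg.
Qed.

Lemma linear_basis1_topological_group : topological_group T.
Proof.
have [_ sB cB] := linB.
split.
  move=> [x y] U /linear_basis1_nbhs[V BV VU].
  have [W BW WV] := cB _ y BV.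
  exists ([set x' | W (x^-1 * x')], [set y' | V (y^-1 * y')]).
    split=> /=; apply/linear_basis1_nbhs; [exists W|exists V] => // v /=;
      by rewrite mulKg.
  case=> x' y' [/= Wx Vy].
  (* The error of [x'], conjugated by [y], times the error of [y']; it is written as a quotient
     because [V] is known to be closed under division. *)
  have -> : x' * y' = x * y * ((x^-1 * x') ^ y / (y^-1 * y')^-1).
    by rewrite conjgE invgK !mulgA !mulgK mulgV mul1g.
  have [V1 VF] := sB _ BV.
  by apply/VU/VF; [exact: WV|rewrite -[_^-1]mul1g; exact: VF].
move=> x U /linear_basis1_nbhs[V BV VU].
have [W BW WV] := cB _ x^-1 BV.
apply/linear_basis1_nbhs; exists W => // w /WV Vw.
have [V1 VF] := sB _ BV.
rewrite /= (_ : (x * w)^-1 = x^-1 * (1 / (w ^ x^-1))).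
  by apply/VU/VF.
by rewrite conjgE !invgM invgK !mulgA mulg1 mulVg mul1g.
Qed.

Hypothesis sepB : forall x, (forall V, B V -> V x) -> x = 1.

Lemma linear_basis1_zero_dimensional : zero_dimensional T.
Proof.
move=> x y /eqP xy.
have [V BV nV] : exists2 V, B V & ~ V (x^-1 * y).
  apply: contrapT => H; apply: xy; apply/esym.
  apply: (@mulgI _ x^-1); rewrite mulVg; apply: sepB => V BV.
  by apply: contrapT => nV; apply: H; exists V.
exists [set z | V (x^-1 * z)]; split=> //.
  by split; [exact: linear_basis1_open_coset|exact: linear_basis1_closed_coset].
by rewrite /= mulVg; case: linB => _ /(_ _ BV)[].
Qed.

End LinearBasis.

Lemma zero_dimensional_hausdorff (T : topologicalType) :
  zero_dimensional T -> hausdorff_space T.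
Proof.
move=> zT; rewrite open_hausdorff => x y /zT[U [[oU cU] Ux nUy]].
exists (U, ~` U); split=> /=; rewrite ?inE //; first exact: closed_openC.
by rewrite setICr.
Qed.

Lemma linear_basis1_quotient (T : groupTopType) (N : normal_subgroup T)
    (B : set (set T)) : linear_basis1 B ->
  @linear_basis1 (quotient N) [set (\pi_(quotient N) : T -> quotient N) @` V | V in B].
Proof.
move=> linB; have [oB sB cB] := linB.
pose p : T -> quotient N := \pi_(quotient N).
have pM x y : p (x * y) = p x * p y by exact: piM.
have pV x : p x^-1 = (p x)^-1 by exact: piV.
have p1 : p 1 = 1 by [].
rewrite -/p; split.
- move=> U; rewrite (_ : open U = open (p @^-1` U)) //; split.
    move=> /oB H a; rewrite -(reprK a) => Ua; have [V BV VU] := H _ Ua.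
    exists (p @` V); first by exists V.
    by move=> _ [v /VU Uv <-]; rewrite -[\pi_ _ _]/(p (repr a)) -pM; exact: Uv.
  move=> H; apply/oB => x /H[_ [V BV <-] VU]; exists V => // v Vv.
  by change (U (p (x * v))); rewrite pM; apply: VU; exists v.
- move=> _ [V /sB[V1 VF] <-]; split; first by exists 1.
  by move=> _ _ [x Vx <-] [y Vy <-]; exists (x / y); [exact: VF|rewrite pM pV].
move=> _ a [V BV <-]; have [W BW WV] := cB _ (repr a) BV.
exists (p @` W); first by exists W.
move=> _ [w /WV Vw <-]; exists (w ^ repr a) => //.
by rewrite !conjgE !pM pV (_ : p (repr a) = a) //; exact: reprK.
Qed.

Lemma topological_group_subgroup (T : groupTopType) (H : subgroup T) :
  topological_group T -> topological_group (set_type H).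
Proof.
case=> cM cV.
have cval : continuous (val : set_type H -> T) by exact: initial_continuous.
split.
  apply/continuousP => _ [A oA <-].
  rewrite (_ : _ @^-1` _ =
    (fun p : set_type H * set_type H => (val p.1, val p.2)) @^-1`
      ((fun p : T * T => p.1 * p.2) @^-1` A)) //.
  apply: open_comp; last by move/continuousP: cM; exact.
  move=> [x y] _ U [[V W] [/= nV nW] VW].
  exists (val @^-1` V, val @^-1` W); first by split; exact: cval.
  by move=> [x' y'] [/= Vx Wy]; apply: VW.
apply/continuousP => _ [A oA <-].
rewrite (_ : _ @^-1` _ = (val : set_type H -> T) @^-1` ((fun x : T => x^-1) @^-1` A)) //.
apply: open_comp; first by move=> x _; exact: cval.
by move/continuousP: cV; exact.
Qed.

(** * Closed subgroups of Sym(omega) and their normalisers *)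

Lemma finite_set_uniform T (A : set T) (P : T -> nat -> Prop) : finite_set A ->
  (forall a, A a -> exists m, forall m', m <= m' -> P a m') ->
  exists m, forall a, A a -> P a m.
Proof.
move=> finA H.
have /choice[f fP] (a : T) : exists m, A a -> forall m', m <= m' -> P a m'.
  by have [/H[m]|nA] := pselect (A a); [exists m|exists 0].
have /finite_seqP[s sE] := finite_image f finA.
exists (\max_(i <- s) i) => a Aa; apply: fP => //.
have : [set` s] (f a) by rewrite -sE; exists a.
by move=> /= fs; rewrite (big_rem _ fs) /= leq_maxl.
Qed.

Lemma infinite_fiber (I : finType) (c : nat -> I) :
  exists i, forall m, exists2 n, m <= n & c n = i.
Proof.
apply: contrapT => H.
have /choice[f fP] (i : I) : exists m, forall n, m <= n -> c n <> i.
  apply: contrapT => Hi; apply: H; exists i => m; apply: contrapT => Hm.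
  by apply: Hi; exists m => n mn cn; apply: Hm; exists n.
by apply: (fP (c (\max_i f i)) _ _ erefl); exact: leq_bigmax.
Qed.

Lemma Sym_closureP (A : set Sym) (p : Sym) : closure A p <->
  forall n, exists2 q : Sym, A q & forall i, i < n -> q i = p i.
Proof.
split=> [cAp n|H U].
  have [] := cAp [set q : Sym | forall i, i < n -> q i = p i]; last first.
    by move=> q [Aq qp]; exists q.
  rewrite nbhsE; exists [set q : Sym | forall i, i < n -> q i = p i] => //.
  split=> //; apply/Sym_openP => q qp; exists n => q' q'q i i_n.
  by rewrite q'q ?qp.
rewrite nbhsE => -[V [/Sym_openP oV /oV[n nV]] VU].
by have [q Aq /nV/VU Uq] := H n; exists q.
Qed.

Lemma closed_subgroup_limit (H : closed_subgroup) (p : Sym) :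
  (forall n, exists2 q : Sym, (H : set Sym) q & forall i, i < n -> q i = p i) ->
  (H : set Sym) p.
Proof. by move=> /Sym_closureP; exact: closed_subgroup_closed. Qed.

Lemma symKV (p : Sym) i : p^-1 (p i) = i.
Proof. by rewrite -[LHS]/((p^-1 * p) i) mulVg. Qed.

Lemma symVK (p : Sym) i : p (p^-1 i) = i.
Proof. by rewrite -[LHS]/((p * p^-1) i) mulgV. Qed.

Section Closed.
Variable G : closed_subgroup.
Implicit Types (g h : G) (p q r : normaliser G) (f : Aut G).

Lemma memG g : (G : set Sym) (val g).
Proof. exact/set_mem/(valP g). Qed.

Lemma memN p : normaliser_set G (val p).
Proof. exact/set_mem/(valP p). Qed.

Lemma G_sub_normaliser (a : Sym) : (G : set Sym) a -> normaliser_set G a.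
Proof.
move=> Ga; apply: normaliser_setP => b; split=> [|Gb]; last first.
  by apply: subgroupM; [exact: subgroupM|exact: subgroupV].
by move=> /(subgroupM (subgroupV Ga))/subgroupM/(_ Ga); rewrite !mulgA mulVg mul1g mulgVK.
Qed.

Lemma normaliser_conjV (a b : Sym) :
  normaliser_set G a -> (G : set Sym) b -> (G : set Sym) (a^-1 * b * a).
Proof.
move=> Na Gb; apply/(normaliser_set_conj (a^-1 * b * a) Na).
by rewrite !mulgA mulgK mulgV mul1g.
Qed.

(** If [d] in the normaliser agrees with a limit [a] on enough points, then the conjugates by [d]
    and by [a] agree on [0, ..., n - 1]. As [G] is closed, [a] and [a^-1] both conjugate [G] into
    itself. *)
Lemma normaliser_set_closed : closed (normaliser_set G).
Proof.
move=> a /Sym_closureP aN; apply: normaliser_setP => b.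
suff [cl clV] : (forall c, (G : set Sym) c -> (G : set Sym) (a * c * a^-1)) /\
    (forall c, (G : set Sym) c -> (G : set Sym) (a^-1 * c * a)).
  split=> [/clV|/cl//]; by rewrite !mulgA mulgVK mulVg mul1g.
split=> c Gc; apply: closed_subgroup_limit => n.
  have [m mP] := bounded_fun (fun i => maxn (a^-1 i) (c (a^-1 i))) n.
  have [d Nd da] := aN m; exists (d * c * d^-1).
    exact/normaliser_set_conj.
  move=> i /mP; rewrite gtn_max => /andP[im cim].
  rewrite -[LHS]/(d (c (d^-1 i))).
  have -> : d^-1 i = a^-1 i by rewrite -[in LHS](symVK a i) -da // symKV.
  exact: da.
have [m mP] := bounded_fun (fun i => maxn i (a^-1 (c (a i)))) n.
have [d Nd da] := aN m; exists (d^-1 * c * d).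
  exact: normaliser_conjV.
move=> i /mP; rewrite gtn_max => /andP[im cim].
rewrite -[LHS]/(d^-1 (c (d i))) da // -[RHS]/(a^-1 (c (a i))).
by rewrite -[in LHS](symVK a (c (a i))) -da // symKV.
Qed.

(** Packaged as a closed subgroup so that completeness, in the form of [close_limit], applies to the
    normaliser. *)
Definition closed_normaliser : closed_subgroup :=
  @ClosedSubgroup (normaliser G) normaliser_set_closed.

Lemma autVK f g : f (f^-1 g) = g.
Proof. by rewrite -[LHS]/((f * f^-1) g) mulgV. Qed.

Lemma autKV f g : f^-1 (f g) = g.
Proof. by rewrite -[LHS]/((f^-1 * f) g) mulVg. Qed.

Lemma aut_image_inv f (A : set G) : (f^-1)%g @` A = f @^-1` A.
Proof.
apply/seteqP; split=> [_ [g Ag <-]|g Ag]; first by rewrite /preimage /= autVK.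
by exists (f g) => //; rewrite autKV.
Qed.

Lemma aut_image_mul f f' (A : set G) : (f * f') @` A = f @` (f' @` A).
Proof. by rewrite image_comp. Qed.

Lemma aut_image_open_coset f (A : set G) : open_coset A -> open_coset (f @` A).
Proof.
move=> [H [x [oH ->]]].
have fH : group_closed (mem (f @` (H : set G))).
  apply: group_closed_set; first by exists 1; [exact: subgroup1|exact: aut1].
  move=> _ _ [a Ha <-] [b Hb <-]; exists (a / b); first exact: subgroupF.
  by rewrite autM autV.
exists (Subgroup fH), (f x); split.
  rewrite /= -[f]invgK aut_image_inv.
  by move/continuousP: (@aut_continuous _ f^-1); exact.
apply/seteqP; split=> [_ [_ [h Hh <-] <-]|_ [_ [h Hh <-] <-]].
  by exists (f h); [exists h|rewrite autM].
by exists (x * h); [exists h|rewrite autM].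
Qed.

(** Automorphisms are homeomorphisms and so permute the cosets of open subgroups; conjugation turns
    the stabiliser of a family into that of its translate. *)
Lemma Aut_linear_basis1 : linear_basis1 (@Aut_basis G : set (set (Aut G))).
Proof.
split=> //.
  move=> _ [C [finC oC] <-]; split; first by move=> A _; exact: image_id.
  move=> f f' fC f'C A CA; rewrite aut_image_mul.
  rewrite (_ : (f'^-1)%g @` A = A) ?fC //.
  by rewrite -{1}(f'C A CA) -aut_image_mul mulVg; exact: image_id.
move=> _ f [C [finC oC] <-].
exists (setwise_stabiliser [set f @` A | A in C]).
  exists [set f @` A | A in C] => //; split; first exact: finite_image.
  by move=> _ [A CA <-]; apply: aut_image_open_coset; exact: oC.
move=> w wC A CA; rewrite conjgE !aut_image_mul wC; last by exists A.
by rewrite -aut_image_mul mulVg; exact: image_id.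
Qed.

End Closed.

(** * Automorphisms induced by permutations *)

(** An n-tuple is a function on [nat] read below [n], so that lengths can vary without casts. *)
Definition orbit_eq (G : set Sym) n (x y : nat -> nat) : Prop :=
  exists2 g : Sym, G g & forall i, i < n -> g (x i) = y i.

Lemma orbit_eq_index (G : closed_subgroup) n : oligomorphic G ->
  exists (k : nat) (c : (nat -> nat) -> 'I_k.+1),
    forall x y, c x = c y <-> orbit_eq G n x y.
Proof.
move=> olG; have /finite_seqP[s sE] := olG n.
pose o (x : nat -> nat) := orbit_of G (fun i : 'I_n => x i).
have os x : o x \in s.
  suff : [set` s] (o x) by [].
  by rewrite -sE; exists (fun i : 'I_n => x i).
exists (size s), (fun x => inord (index (o x) s)) => x y; split.
  move=> /(congr1 val); rewrite /= !inordK ?ltnS ?index_size //.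
  move=> /(congr1 (nth set0 s)); rewrite !nth_index // => oxy.
  have : o y (fun i : 'I_n => y i) by exists 1; [exact: subgroup1|].
  rewrite -oxy => -[g Gg gE]; exists g => // i i_n.
  exact: (congr1 (@^~ (Ordinal i_n)) gE).
move=> [g Gg gE]; congr (inord (index _ s)).
have yE : (fun i : 'I_n => y i) = g \o (fun i : 'I_n => x i).
  by apply/funext => i; rewrite /= gE.
rewrite /o yE; apply/seteqP; split=> _ [h Gh <-].
  exists (h * g^-1); first exact: subgroupF.
  by apply/funext => i; rewrite /= -[LHS]/(h (g^-1 (g (x i)))) symKV.
by exists (h * g) => //; exact: subgroupM.
Qed.

Section Oligomorphic.
Variable G : closed_subgroup.
Hypothesis olG : oligomorphic G.
Implicit Types (g h : G) (p q r : normaliser G) (f : Aut G).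

(** Oligomorphy for 1-tuples: [rho a] represents the orbit of [a], and [tau a] carries it to [a]. *)
Lemma orbit_representatives : exists (K : nat) (rho : nat -> nat) (tau : nat -> G),
  [/\ forall a, rho a < K, forall a, val (tau a) (rho a) = a
    & forall g a, rho (val g a) = rho a].
Proof.
have [k [c cP]] := orbit_eq_index 1 olG.
have /choice[s sP] (i : 'I_k.+1) :
    exists a, forall b, c (fun=> b) = i -> c (fun=> a) = i.
  have [[a ai]|H] := pselect (exists a, c (fun=> a) = i); first by exists a.
  by exists 0 => b bi; case: H; exists b.
pose rho a := s (c (fun=> a)).
have /choice[tau tauP] a : exists g : G, val g (rho a) = a.
  have /cP[g Gg gE] : c (fun=> rho a) = c (fun=> a) by exact: (sP _ a).
  by exists (exist _ g (mem_set Gg)); exact: gE 0 _.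
exists (\max_i (s i).+1), rho, tau; split=> //.
  by move=> a; rewrite /rho; exact: (@leq_bigmax _ (fun i => (s i).+1)).
move=> g a; rewrite /rho; congr s; apply/esym/cP.
by exists (val g) => //; exact: memG.
Qed.

Definition transporter (a b : nat) : set G := [set g : G | val g a = b].

Lemma open_coset_transporter (a b : nat) g : val g a = b ->
  open_coset (transporter a b).
Proof.
move=> gab.
have Ha : group_closed (mem (transporter a a)).
  apply: group_closed_set => // x y xa ya.
  have yVa : val y^-1 a = a by rewrite -[in LHS](ya : val y a = a) valKg.
  exact: etrans (congr1 (val x) yVa) xa.
exists (Subgroup Ha), g; split.
  apply/G_openP => x xa; exists a.+1 => y yx; rewrite /= /transporter /=.
  by rewrite yx.
apply/seteqP; split=> [h hab|_ [h ha <-]]; last first.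
  exact: etrans (congr1 (val g) ha) gab.
exists (g^-1 * h); last by rewrite mulVKg.
by apply: etrans (congr1 (val g^-1) hab) _; rewrite -gab valKg.
Qed.

Section Lift.
Variables (rho : nat -> nat) (tau : nat -> G).
Hypothesis tauE : forall a, val (tau a) (rho a) = a.
Hypothesis rhoE : forall g a, rho (val g a) = rho a.

Lemma rho_idem a : rho (rho a) = rho a.
Proof. by rewrite -[in RHS](tauE a) rhoE. Qed.

Definition lift_fun f a := val (f (tau a)) (rho a).

Definition fixes_representatives f : Prop :=
  forall a, f @` transporter (rho a) (rho a) = transporter (rho a) (rho a).

(** Well-definedness: two elements of [G] with the same value at [rho a] differ by an element of its
    stabiliser, which [f] preserves. *)
Lemma lift_funE f : fixes_representatives f ->
  forall g a, lift_fun f (val g (rho a)) = val (f g) (rho a).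
Proof.
move=> ff g a; rewrite /lift_fun rhoE rho_idem; set b := val g (rho a).
have bE : val (tau b) (rho a) = b by rewrite -[in LHS](rho_idem a) -(rhoE g) tauE.
have : transporter (rho a) (rho a) (f (g^-1 * tau b)).
  rewrite -[X in X _]ff; exists (g^-1 * tau b) => //.
  by apply: etrans (congr1 (val g^-1) bE) _; rewrite valKg.
rewrite autM autV => /(congr1 (val (f g))); rewrite -valMg mulVKg => <-.
by [].
Qed.

Lemma lift_funK f f' : fixes_representatives f -> fixes_representatives f' ->
  cancel f f' -> cancel (lift_fun f) (lift_fun f').
Proof.
by move=> ff ff' fK a; rewrite -{1}(tauE a) !lift_funE // fK tauE.
Qed.

Lemma fixes_representativesV f :
  fixes_representatives f -> fixes_representatives f^-1.
Proof.
move=> ff a; rewrite -{1}(ff a) -aut_image_mul mulVg; exact: image_id.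
Qed.

Lemma lift_exists f : fixes_representatives f ->
  exists2 p, conj_hom p = f & forall g a, val p (val g (rho a)) = val (f g) (rho a).
Proof.
move=> ff; have ffV := fixes_representativesV ff.
pose a := sym_of (Bijective (lift_funK ff ffV (autKV f)) (lift_funK ffV ff (autVK f))).
have aE g : a * val g * a^-1 = val (f g).
  apply: (canLR (mulgK _)); apply/symP => b; rewrite -(tauE b).
  rewrite -[LHS]/(lift_fun f (val g (val (tau b) (rho b)))) -valMg lift_funE //.
  by rewrite -[RHS]/(val (f g) (lift_fun f (val (tau b) (rho b)))) lift_funE // autM.
have Na : normaliser_set G a.
  rewrite /normaliser_set /=; apply/seteqP; split=> [_ [g Gg <-]|g Gg].
    by have := aE (exist _ g (mem_set Gg)) => /= ->; exact: memG.
  pose g' : G := exist _ g (mem_set Gg).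
  by exists (val (f^-1 g')); [exact: memG|rewrite aE autVK].
exists (exist _ a (mem_set Na)); last by move=> g b; exact: lift_funE.
by apply/autP => g; apply: val_inj; rewrite -aE.
Qed.

End Lift.

Lemma Aut_basis_lift m : exists2 V, @Aut_basis G V &
  forall f, V f -> exists2 p, conj_hom p = f & forall i, i < m -> val p i = i.
Proof.
have [K [rho [tau [rhoK tauE rhoE]]]] := orbit_representatives.
(* The first family makes [f] liftable. The second makes the lift fix each [i < m], as [f (tau i)]
   still sends [rho i] to [i]. *)
pose C := [set transporter (rho a) (rho a) | a in [set: nat]] `|`
          [set transporter (rho i) i | i in `I_m].
exists (setwise_stabiliser C).
  exists C => //; split; last first.
    move=> _ [[a _ <-]|[i _ <-]]; first exact: (@open_coset_transporter _ _ 1).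
    exact: (open_coset_transporter (tauE i)).
  rewrite finite_setU; split; last exact/finite_image/finite_II.
  apply: (@sub_finite_set _ _ [set transporter i i | i in `I_K]).
    by move=> _ [a _ <-]; exists (rho a) => //; exact: rhoK.
  exact/finite_image/finite_II.
move=> f fC; have [|p pf pE] := lift_exists tauE rhoE (f := f).
  by move=> a; apply: fC; left; exists a.
exists p => // i i_m.
have : transporter (rho i) i (f (tau i)).
  rewrite -[X in X _](fC (transporter (rho i) i)); last by right; exists i.
  by exists (tau i) => //; exact: tauE.
by rewrite -[in LHS](tauE i) pE.
Qed.

End Oligomorphic.

(** * The action of the normaliser on orbits of tuples *)

(** On the normaliser: [p] and [q] induce the same map on the orbits of [G] on n-tuples. *)
Definition same_orbit_action (G : set Sym) n (p q : Sym) : Prop :=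
  forall x : nat -> nat, orbit_eq G n (p \o x) (q \o x).

Section SameOrbitAction.
Variable G : closed_subgroup.
Implicit Types (g h : G) (p q r : normaliser G) (f : Aut G) (a b c : Sym).

Lemma same_orbit_action_sym n a b :
  same_orbit_action G n a b -> same_orbit_action G n b a.
Proof.
move=> ab x; have [g Gg gE] := ab x.
by exists g^-1; [exact: subgroupV|move=> i i_n; rewrite -gE // symKV].
Qed.

Lemma same_orbit_action_trans n b a c : same_orbit_action G n a b ->
  same_orbit_action G n b c -> same_orbit_action G n a c.
Proof.
move=> ab bc x; have [g Gg gE] := ab x; have [h Gh hE] := bc x.
exists (h * g); first exact: subgroupM.
by move=> i i_n; rewrite -hE // -gE.
Qed.

Lemma same_orbit_actionW n m a b : n <= m ->
  same_orbit_action G m a b -> same_orbit_action G n a b.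
Proof.
move=> nm ab x; have [g Gg gE] := ab x.
by exists g => // i i_n; apply: gE; exact: leq_trans nm.
Qed.

Lemma same_orbit_action_mull n g a : same_orbit_action G n a (val g * a).
Proof. by move=> x; exists (val g); first exact: memG. Qed.

Lemma same_orbit_action_conj n p a b : same_orbit_action G n a b ->
  same_orbit_action G n (val p * a) (val p * b).
Proof.
move=> ab x; have [g Gg gE] := ab x.
exists (val p * g * (val p)^-1); first exact/normaliser_set_conj/Gg/memN.
move=> i i_n; rewrite -[LHS]/(val p (g ((val p)^-1 (val p (a (x i)))))) symKV.
by rewrite (gE i i_n : g (a (x i)) = b (x i)).
Qed.

(** A normaliser element maps orbits to orbits, so its action is coded by a function on finitely
    many colours, computed at representatives. *)
Lemma same_orbit_action_index n : oligomorphic G ->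
  exists (I : finType) (c : normaliser G -> I),
    forall p q, c p = c q -> same_orbit_action G n (val p) (val q).
Proof.
move=> /(@orbit_eq_index G n)[k [c cP]].
have /choice[s sP] (i : 'I_k.+1) : exists x, forall y, c y = i -> c x = i.
  have [[x xi]|H] := pselect (exists x, c x = i); first by exists x.
  by exists id => y yi; case: H; exists y.
exists {ffun 'I_k.+1 -> 'I_k.+1}, (fun p => [ffun i => c (val p \o s i)]) => p q.
move=> /ffunP pq x; apply/cP.
have /cP[g Gg gE] : c x = c (s (c x)) by rewrite (sP _ x).
have step r : c (val r \o x) = c (val r \o s (c x)).
  apply/cP; exists (val r * g * (val r)^-1); first exact/normaliser_set_conj/Gg/memN.
  move=> i i_n; rewrite -[LHS]/(val r (g ((val r)^-1 (val r (x i))))) symKV.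
  by rewrite gE.
by rewrite !step; have := pq (c x); rewrite !ffunE.
Qed.

(** For [a] in [x H], some [g] in [G] moves the points [x i] and [a i], [i < n], as [p] does. It
    fixes the [x i], so [g x H = x H]; and [g * a] agrees below [n] with the conjugate of [a] by
    [p], so these lie in the same left coset of [H]. *)
Lemma open_coset_stable (A : set G) : open_coset A ->
  exists m, forall m', m <= m' -> forall p,
    (forall i, i < m' -> val p i = i) -> same_orbit_action G m' 1 (val p) ->
    conj_hom p @` A = A.
Proof.
move=> [H [x [/G_openP oH ->]]].
have [n nH] := oH _ (subgroup1 H).
have [l lx] := bounded_fun (val x) n.
(* [l] bounds the points [x i], which [p] has to fix; [n + n] is the length of the joint tuple. *)
exists (maxn l (n + n)) => m; rewrite geq_max => /andP[lm nnm].
suff sub p : (forall i, i < m -> val p i = i) -> same_orbit_action G m 1 (val p) ->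
    conj_hom p @` [set x * h | h in H] `<=` [set x * h | h in H].
  move=> p pE p1; apply/seteqP; split; first exact: sub.
  have pVE i : i < m -> val p^-1 i = i.
    by move=> i_m; rewrite -[in LHS](pE i i_m); exact: symKV.
  have pV1 : same_orbit_action G m 1 (val p^-1).
    have := same_orbit_action_conj p^-1 p1.
    by rewrite -[_ * val p]/(val (p^-1 * p)) mulVg mulg1 => /same_orbit_action_sym.
  move=> y Ay; exists (conj_hom p^-1 y); first by apply: sub pVE pV1 _ _; exists y.
  rewrite -[LHS]/((conj_hom p * conj_hom p^-1) y) -conj_homM mulgV.
  by apply: val_inj => /=; rewrite invg1 mulg1 mul1g.
move=> pE p1 _ [_ [h Hh <-] <-]; set a := x * h.
have [b Gb bE] := p1 (fun i => if i < n then val x i else val a (i - n)).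
pose g : G := exist _ b (mem_set Gb).
have gx i : i < n -> val g (val x i) = val x i.
  move=> i_n; have i_m : i < m by apply: leq_trans i_n (leq_trans (leq_addr n n) nnm).
  have := bE i i_m; rewrite /= i_n => ->; apply: pE.
  exact: leq_trans (lx i i_n) lm.
have ga i : i < n -> val g (val a i) = val p (val a i).
  move=> i_n; have i_m : n + i < m by apply: leq_trans nnm; rewrite ltn_add2l.
  by have := bE _ i_m; rewrite /= addKn ltnNge leq_addr.
have H1 : (H : set G) (x^-1 * g * x).
  apply: nH => i i_n; rewrite -[LHS]/(val x^-1 (val g (val x i))) gx //.
  exact: valKg.
have H2 : (H : set G) ((g * a)^-1 * conj_hom p a).
  apply: nH => i i_n.
  have i_m : i < m by apply: leq_trans i_n (leq_trans (leq_addr n n) nnm).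
  rewrite -[LHS]/(val (g * a)^-1 (val p (val a ((val p)^-1 i)))).
  have -> : (val p)^-1 i = i by rewrite -[in LHS](pE i i_m); exact: symKV.
  by rewrite -ga //; exact: (valKg (g * a)).
exists (x^-1 * g * x * h * ((g * a)^-1 * conj_hom p a)).
  by apply: subgroupM H2; exact: subgroupM.
by rewrite /a !mulgA mulgV mul1g mulgV mul1g.
Qed.

Lemma Aut_basis_stable V : @Aut_basis G V ->
  exists m, forall p, (forall i, i < m -> val p i = i) ->
    same_orbit_action G m 1 (val p) -> V (conj_hom p).
Proof.
move=> [C [finC oC] <-].
have [A /oC|m mP] := finite_set_uniform (P := fun A m => forall p,
    (forall i, i < m -> val p i = i) -> same_orbit_action G m 1 (val p) ->
    conj_hom p @` A = A) finC.
  exact: open_coset_stable.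
by exists m => p pE p1 A /mP; exact.
Qed.

Lemma Inn_conj_hom p : (G : set Sym) (val p) -> Inn_set (conj_hom p).
Proof. by move=> Gp; exists (exist _ (val p) (mem_set Gp)) => x; apply: val_inj. Qed.

(** Since [p] preserves the orbit of the tuple [0, ..., m - 1], an element of [G] undoes [p] on
    these points, which supplies the fixed points that [Aut_basis_stable] asks for. *)
Lemma Aut_basis_same_orbit_action V : @Aut_basis G V -> exists m, forall p,
  same_orbit_action G m 1 (val p) -> exists2 q, (G : set Sym) (val q) & V (conj_hom (q * p)).
Proof.
move=> /Aut_basis_stable[m mP]; exists m => p p1.
have [g Gg gE] := p1 id.
pose q : normaliser G := exist _ g (mem_set (G_sub_normaliser Gg)).
have Gq : (G : set Sym) (val q^-1) by exact: subgroupV.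
exists q^-1 => //; apply: mP.
  move=> i i_m; rewrite -[LHS]/(g^-1 (val p i)) -(gE i i_m : g i = val p i).
  exact: symKV.
apply: same_orbit_action_trans p1 _.
exact: (@same_orbit_action_mull _ (exist _ (val q^-1) (mem_set Gq))).
Qed.

(** Left translation by [G] does not change the action on orbits, so the [s n] can be replaced by
    translates that converge. *)
Lemma normaliser_limit (s : nat -> normaliser G) :
  (forall n m, n <= m -> same_orbit_action G n (val (s n)) (val (s m))) ->
  exists p, forall n, same_orbit_action G n (val p) (val (s n)).
Proof.
move=> sW.
(* Level [k + k] leaves room for [k] points together with [k] preimages. *)
pose P k (t : closed_normaliser G) := same_orbit_action G (k + k) (val t) (val (s (k + k))).
have [|k t Pt|t [_ Pt tS]] := @dependent_choice _ P (@Defs.close (closed_normaliser G)) (s 0).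
- by move=> x; exists 1; first exact: subgroup1.
- have : same_orbit_action G (k + k) (val (s (k.+1 + k.+1))) (val t).
    apply: same_orbit_action_sym; apply: same_orbit_action_trans Pt _.
    by apply: sW; rewrite leq_add.
  (* Forth on the points below [k], back on their preimages under [t]: the translate and its inverse
     then agree with [t] and [t^-1] below [k]. *)
  move=> /(_ (fun i => if i < k then i else val t^-1 (i - k))) [g Gg gE].
  pose q : normaliser G := exist _ g (mem_set (G_sub_normaliser Gg)).
  exists (q * s (k.+1 + k.+1)).
    apply: same_orbit_action_sym.
    exact: (@same_orbit_action_mull _ (exist _ g (mem_set Gg))).
  set u : closed_normaliser G := q * _.
  have uE i : i < k -> val u i = val t i.
    move=> i_k; have := gE i (leq_trans i_k (leq_addr k k)).
    by rewrite /= i_k.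
  have utE i : i < k -> val u (val t^-1 i) = i.
    move=> i_k; have := gE (k + i); rewrite ltn_add2l => /(_ i_k) /=.
    rewrite ltnNge leq_addr /= addKn => uE'; apply: etrans uE' _.
    exact: symVK.
  split=> i i_k; first by rewrite uE.
  by apply: (bij_inj (sym_bij (val u))); rewrite utE // valVKg.
have [p pP] := close_limit tS.
exists p => n x.
have [m mP] := bounded_fun x n.
(* Large enough for [p] and [t k] to agree on all entries [x i], [i < n]. *)
pose k := maxn n m.
have kn : n <= k + k by apply: leq_trans (leq_maxl n m) (leq_addr k k).
have [g Gg gE] := same_orbit_action_trans (same_orbit_actionW kn (Pt k))
  (same_orbit_action_sym (sW _ _ kn)) x.
exists g => // i i_n; rewrite -gE //=; congr (g _); apply/esym.
have [pk _] := pP k; apply: pk.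
by apply: leq_trans (mP _ i_n) (leq_maxr n m).
Qed.

End SameOrbitAction.

(** * The outer automorphism group *)

Section OuterAutomorphisms.
Variable G : closed_subgroup.
Implicit Types (g h : G) (p q r : normaliser G) (f : Aut G).

Definition outer f : Out G := \pi_(quotient (Inn G)) f.

Lemma outerM f f' : outer (f * f') = outer f * outer f'.
Proof. exact: piM. Qed.

Lemma outer_eq f f' : outer f = outer f' <-> Inn_set (f^-1 * f').
Proof. exact: eq_quotient. Qed.

Lemma outer_surj (x : Out G) : exists f, outer f = x.
Proof. by exists (repr x); exact: reprK. Qed.

Lemma outer_conj_hom_eq p q : (G : set Sym) (val (p^-1 * q)) ->
  outer (conj_hom p) = outer (conj_hom q).
Proof.
move=> /Inn_conj_hom pq; apply/outer_eq.
rewrite (_ : (conj_hom p)^-1 * conj_hom q = conj_hom (p^-1 * q)) //.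
by apply: (canLR (mulKg _)); rewrite -conj_homM mulVKg.
Qed.

Lemma Out_linear_basis1 :
  linear_basis1 ([set outer @` V | V in @Aut_basis G] : set (set (Out G))).
Proof. exact: linear_basis1_quotient (@Aut_linear_basis1 G). Qed.

Lemma range_mod_InnP (x : Out G) :
  (range_mod_Inn G : set (Out G)) x <-> exists p, outer (conj_hom p) = x.
Proof.
split=> [[_ [p _ <-] <-]|[p <-]]; first by exists p.
by exists (conj_hom p) => //; exists p.
Qed.

Hypothesis olG : oligomorphic G.

Lemma open_range_conj_hom : open (range (@conj_hom G)).
Proof.
move=> _ [p _ <-]; have [V BV VN] := Aut_basis_lift olG 0.
by exists V => // _ /VN[q <- _]; exists (p * q) => //; rewrite conj_homM.
Qed.

(** As range(S) contains Inn(G), it is the full preimage of its image in Out(G). *)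
Lemma open_range_mod_Inn : open (range_mod_Inn G : set (Out G)).
Proof.
rewrite (_ : open _ = open (outer @^-1` (range_mod_Inn G : set (Out G)))) //.
rewrite (_ : _ @^-1` _ = range (@conj_hom G)); first exact: open_range_conj_hom.
apply/seteqP; split=> [f|f fN]; last by exists f.
move=> [f' [p _ <-] /outer_eq/Inn_sub_range_conj_hom[q _ qE]].
by exists (p * q) => //; rewrite conj_homM qE mulVKg.
Qed.

(** Finiteness of the centraliser. Its elements are determined by their values at orbit
    representatives, which are below [K]. If [g] in [G] carries the tuple of [a] to that of [b],
    then [g] fixes every [i < K], so [b i = g (a i) = a (g i) = a i]. *)
Lemma centraliser_index : exists (I : finType) (c : Sym -> I), forall a b : Sym,
  (forall g, a * val g = val g * a) -> (forall g, b * val g = val g * b) ->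
  c a = c b -> a = b.
Proof.
have [K [rho [tau [rhoK tauE rhoE]]]] := orbit_representatives olG.
have [k [c cP]] := orbit_eq_index (K + K) olG.
pose t (a : Sym) i := if i < K then i else a (i - K).
exists 'I_k.+1, (c \o t) => a b aC bC /cP[g Gg gE].
pose g' : G := exist _ g (mem_set Gg).
have ab i : i < K -> a i = b i.
  move=> iK.
  have gi : g i = i by have := gE i (leq_trans iK (leq_addr K K)); rewrite /t iK.
  have := gE (K + i); rewrite ltn_add2l => /(_ iK).
  rewrite /t ltnNge leq_addr /= addKn => <-.
  by rewrite -[RHS]/((val g' * a) i) -aC -[RHS]/(a (g i)) gi.
apply/symP => i; rewrite -(tauE i).
rewrite -[LHS]/((a * val (tau i)) (rho i)) aC -[RHS]/((b * val (tau i)) (rho i)) bC.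
by rewrite -[LHS]/(val (tau i) (a (rho i))) ab.
Qed.

(* If [f] is conjugation by [p] and [f] composed with conjugation by [g m] in [G]
   is conjugation by [r m], where [r m] tends to 1, then [r m = p * g m * z m]
   with [z m] in the finite centraliser of [G]. For infinitely many [m] this is a
   fixed [z], and then [(p * z)^-1] is a limit of elements [g m] of [G]. *)
Lemma Inn_closure f :
  (forall V, @Aut_basis G V -> exists2 f', Inn_set f' & V (f * f')) -> Inn_set f.
Proof.
move=> fV.
have H m : exists rg : normaliser G * normaliser G,
    [/\ (G : set Sym) (val rg.2), conj_hom rg.1 = f * conj_hom rg.2
      & forall i, i < m -> val rg.1 i = i].
  have [V BV VN] := Aut_basis_lift olG m.
  have [f' [g f'E] /VN[r rf ri]] := fV _ BV.
  exists (r, exist _ (val g) (mem_set (G_sub_normaliser (memG g)))); split=> //=.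
    exact: memG.
  rewrite rf; congr (_ * _); apply/autP => x; rewrite f'E; exact: val_inj.
have /choice[rg rgP] := H.
pose r m := (rg m).1; pose g m := (rg m).2.
pose p := r 0 * (g 0)^-1.
have fp : f = conj_hom p.
  have [_ r0 _] := rgP 0.
  apply: (@mulIg _ (conj_hom (g 0))); rewrite -conj_homM mulgVK; exact/esym.
pose z m := (p * g m)^-1 * r m.
have zE m : conj_hom (z m) = 1.
  rewrite conj_homM; have [_ -> _] := rgP m.
  rewrite fp -conj_homM -conj_homM mulVg.
  by apply/autP => y; apply: val_inj; rewrite /= invg1 mulg1 mul1g.
have zC m (x : G) : val (z m) * val x = val x * val (z m).
  have := congr1 (fun f : Aut G => val (f x)) (zE m).
  by move=> /(congr1 (fun a => a * val (z m))) /=; rewrite mulgVK.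
have [I [c cP]] := centraliser_index.
have [i iP] := infinite_fiber (fun m => c (val (z m))).
have [k _ ki] := iP 0.
have zk m : exists2 n, m <= n & z n = z k.
  by have [n mn ni] := iP m; exists n => //; apply/val_inj/cP; rewrite ?ni.
have Gpz : (G : set Sym) (val (p * z k)^-1).
  apply: closed_subgroup_limit => m; have [n mn zn] := zk m.
  exists (val (g n)); first by have [] := rgP n.
  move=> j j_m.
  (* [z n] centralises [g n], so [r n = p * z n * g n]; as [r n] fixes [j], the values of
     [(p * z k)^-1] and [g n] at [j] agree. *)
  have -> : (p * z k)^-1 = g n * (r n)^-1.
    rewrite -zn; have -> : p * z n = r n * (g n)^-1.
      have gz : g n * z n = z n * g n.
        have [Gg _ _] := rgP n.
        apply: val_inj; rewrite -[LHS]/(val (g n) * val (z n))%g.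
        rewrite -[RHS]/(val (z n) * val (g n))%g.
        by rewrite -(zC n (exist _ (val (g n)) (mem_set Gg))).
      apply: (canRL (mulgK _)); rewrite -mulgA -gz mulgA.
      by rewrite /z mulVKg.
    by rewrite invgM invgK.
  have [_ _ ri] := rgP n.
  have rj : val (r n) j = j by apply: ri; exact: leq_trans mn.
  rewrite -[RHS]/(val (g n) ((val (r n))^-1 j)).
  by rewrite -[in RHS]rj symKV.
rewrite fp -[conj_hom p]mulg1 -(zE k) -conj_homM.
apply: Inn_conj_hom; rewrite -[p * z k]invgK.
exact: (subgroupV Gpz).
Qed.

(** If [outer f] lies in all these images, then [f] lies in the closure of Inn(G). *)
Lemma Out_separated (x : Out G) :
  (forall V, [set outer @` V | V in @Aut_basis G] V -> V x) -> x = 1.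
Proof.
have [f <-] := outer_surj x => H.
suff /Inn_closure[g fE] : forall V, @Aut_basis G V -> exists2 f', Inn_set f' & V (f * f').
  by apply/esym/outer_eq; rewrite invg1 mul1g; exists g.
move=> V BV; have [|v Vv /esym/outer_eq fv] := H (outer @` V); first by exists V.
by exists (f^-1 * v); rewrite ?mulVKg.
Qed.

Lemma Out_zero_dimensional : zero_dimensional (Out G).
Proof.
exact: linear_basis1_zero_dimensional Out_linear_basis1 Out_separated.
Qed.

Lemma ultra_finite_index T (F : set_system T) (I : finType) (c : T -> I) :
  UltraFilter F -> exists i, F [set x | c x = i].
Proof.
move=> UF; apply: contrapT => H.
have /filter_ex[x /(_ (c x))] : \forall x \near F, forall i, c x <> i; last by [].
apply: filter_forall => i; have [Fi|//] := in_ultra_setVsetC [set x | c x = i] UF.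
by exfalso; apply: H; exists i.
Qed.

Lemma compact_range_mod_Inn : compact [set: set_type (range_mod_Inn G)].
Proof.
rewrite compact_ultra => F UF _.
have /choice[c cE] (x : set_type (range_mod_Inn G)) : exists p, outer (conj_hom p) = val x.
  exact/range_mod_InnP/set_mem/(valP x).
(* [s n] has the action on orbits of n-tuples shared by [F]-almost all [c x]. *)
have /choice[s sP] n : exists q,
    F [set x | same_orbit_action G n (val q) (val (c x))].
  have [I [d dP]] := same_orbit_action_index n olG.
  have [i Fi] := ultra_finite_index (d \o c) UF.
  have [x xi] := filter_ex Fi; exists (c x); apply: filterS Fi => y yi.
  by apply: dP; rewrite [LHS]xi; exact/esym.
(* The sets of [F] chosen for [n] and for [m] meet, so the actions are coherent. *)
have [n m nm|p pP] := @normaliser_limit _ s.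
  have [x [xn xm]] := filter_ex (filterI (sP n) (sP m)).
  apply: same_orbit_action_trans xn _.
  exact/same_orbit_action_sym/(same_orbit_actionW nm).
have Pp : (range_mod_Inn G : set (Out G)) (outer (conj_hom p)).
  by apply/range_mod_InnP; exists p.
exists (exist _ (outer (conj_hom p)) (mem_set Pp)); split=> // U.
rewrite nbhsE => -[_ [[O oO <-] /= Op] OU].
have /(linear_basis1_nbhs Out_linear_basis1)[_ [V BV <-] VO] : nbhs (outer (conj_hom p)) O.
  exact: open_nbhs_nbhs.
have [m mP] := Aut_basis_same_orbit_action BV.
apply: filterS (sP m) => x xm; apply: OU; suff: O (outer (conj_hom (c x))) by rewrite cE.
have [|q Gq Vq] := mP (p^-1 * c x).
  have := same_orbit_action_conj p^-1 (same_orbit_action_trans (pP m) xm).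
  by rewrite -[_ * val p]/(val (p^-1 * p)) mulVg.
have -> : outer (conj_hom (c x)) =
    outer (conj_hom p) * outer (conj_hom (q * (p^-1 * c x))).
  rewrite conj_homM outerM -[outer (conj_hom q)](_ : outer (conj_hom 1) = _).
    by rewrite -!outerM -!conj_homM mul1g mulVKg.
  by apply: outer_conj_hom_eq; rewrite invg1 mul1g.
by apply: VO; exists (conj_hom (q * (p^-1 * c x))).
Qed.

End OuterAutomorphisms.

(** * Finite signatures *)

Section StructureAutomorphism.
Variables (L : signature) (D : Type) (M : structure L D) (s : D -> D).
Hypothesis s_bij : bijective s.
Hypothesis s_fun : forall t x, s (finterp M x) = @finterp _ _ M t (s \o x).
Hypothesis s_rel : forall t x, @rinterp _ _ M t (s \o x) <-> rinterp M x.

Lemma eval_automorphism n (t : term L n) v : Defs.eval M (s \o v) t = s (Defs.eval M v t).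
Proof.
elim: t => //= t ts IH; rewrite s_fun; congr finterp.
by apply/funext => i; exact: IH.
Qed.

Lemma sat_automorphism n (phi : formula L n) v : sat M phi (s \o v) <-> sat M phi v.
Proof.
elim: n / phi v => [//|n t u|n t ts|n phi IH psi IH'|n phi IH] v /=.
- rewrite !eval_automorphism; split=> [|->//]; exact: (bij_inj s_bij).
- rewrite -[X in _ <-> X]s_rel; suff -> : (fun i => Defs.eval M (s \o v) (ts i)) =
    s \o (fun i => Defs.eval M v (ts i)) by [].
  by apply/funext => i /=; rewrite eval_automorphism.
- by split=> H /IH/H/IH'.
have extE a : extend (s a) (s \o v) = s \o extend a v.
  by apply/funext => i; rewrite /extend /=; case: unlift.
split=> [H a|H a]; first by apply/IH; rewrite -extE.
have [s' sK s'K] := s_bij.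
by rewrite -(s'K a) extE; apply/IH.
Qed.

Lemma definable_automorphism n (R : set ('I_n -> D)) v :
  definable M R -> R (s \o v) <-> R v.
Proof. by move=> [phi ->]; exact: sat_automorphism. Qed.

End StructureAutomorphism.

Lemma definable_fun_graph L D (M : structure L D) t :
  definable M [set v | v ord0 = @finterp _ _ M t (fun i => v (lift ord0 i))].
Proof. by exists (Equal (Var _ ord0) (App (fun i => Var _ (lift ord0 i)))). Qed.

Lemma definable_rel L D (M : structure L D) t : definable M (@rinterp _ _ M t).
Proof. by exists (Rel (fun i => Var _ i)). Qed.

Section FiniteSignature.
Variable G : closed_subgroup.
Implicit Types (g h : G) (p q r : normaliser G).

Lemma definable_canonical n (R : set ('I_n -> nat)) (a : Sym) v :
  (G : set Sym) a -> definable (canonical_structure G) R -> R (a \o v) <-> R v.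
Proof.
move=> Ga; apply: definable_automorphism => [|[]|]; first exact: sym_bij.
move=> [k k_gt0 O orbO] x /=; have [u _ uO] := orbO; rewrite -uO; split=> [[b Gb bE]|[b Gb <-]].
  exists (a^-1 * b); first by apply: subgroupM Gb; exact: subgroupV.
  apply/funext => i; rewrite -[LHS]/(a^-1 ((b \o u) i)) bE.
  exact: symKV.
by exists (a * b); first exact: subgroupM.
Qed.

Lemma same_orbit_action1_tuple n k (a : Sym) (v : 'I_k -> nat) :
  same_orbit_action G n 1 a -> k <= n ->
  exists2 b : Sym, (G : set Sym) b & b \o v = a \o v.
Proof.
move=> a1 kn.
(* The tuple is padded with 0 beyond [k]. *)
have [b Gb bE] := a1 (fun i => oapp v 0 (insub i)).
exists b => //; apply/funext => i.
by have := bE i (leq_trans (ltn_ord i) kn); rewrite /= valK.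
Qed.

(** With [n] above all arities, [a] agrees on each short enough tuple with an element of [G], so it
    preserves the symbols of [M], hence every relation definable in [M], hence the orbits of [G].
    Closedness then puts [a] in [G]. *)
Lemma finite_signature_orbits L (M : structure L nat) : finite_signature L ->
  interdefinable (canonical_structure G) M ->
  exists n, forall a : Sym, same_orbit_action G n 1 a -> (G : set Sym) a.
Proof.
move=> [finF finR] GM.
(* A function symbol is handled through its graph, which has one more coordinate. *)
have [t _|n1 n1P] := finite_set_uniform (P := fun t m => (farity t).+1 <= m) finF.
  by exists (farity t).+1.
have [t _|n2 n2P] := finite_set_uniform (P := fun t m => rarity t <= m) finR.
  by exists (rarity t).
exists (maxn n1 n2) => a a1; apply: closed_subgroup_limit => m.
have aut n (R : set ('I_n -> nat)) v : definable M R -> R (a \o v) <-> R v.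
  apply: definable_automorphism; first exact: sym_bij.
    move=> t x.
    pose v' : 'I_(farity t).+1 -> nat := extend (finterp M x) x.
    have [|b Gb bE] := @same_orbit_action1_tuple _ _ a v' a1.
      by rewrite leq_max n1P.
    have [_] := definable_canonical v' Gb ((GM _ _).2 (definable_fun_graph M t)).
    rewrite bE /= /v' /extend unlift_none /= => H.
    rewrite H; last by congr finterp; apply/funext => i; rewrite liftK.
    by congr finterp; apply/funext => i; rewrite /= liftK.
  move=> t x.
  have [|b Gb bE] := @same_orbit_action1_tuple _ _ a x a1.
    by rewrite leq_max n2P ?orbT.
  by have := definable_canonical x Gb ((GM _ _).2 (definable_rel M t)); rewrite bE.
(* Length [m.+1] because symbols of the canonical structure have positive arity. *)
pose v (i : 'I_m.+1) : nat := i.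
have Ov : orbits G m.+1 (orbit_of G v) by exists v.
have /GM dO := definable_rel (canonical_structure G) (OrbitSymbol (ltn0Sn m) Ov).
have [_ []] := aut _ _ v dO; first by exists 1; first exact: subgroup1.
move=> b Gb bE; exists b => // i i_m.
by have := congr1 (fun u => u (Ordinal (leqW i_m))) bE.
Qed.

Hypothesis olG : oligomorphic G.

(** If [p] and [q] act alike on orbits of n-tuples, then [p^-1 * q] acts trivially, so it lies in
    [G] and the classes coincide. *)
Lemma finite_range_mod_Inn n :
  (forall a : Sym, same_orbit_action G n 1 a -> (G : set Sym) a) ->
  finite_set (range_mod_Inn G : set (Out G)).
Proof.
move=> nG; have [I [c cP]] := same_orbit_action_index n olG.
have /choice[s sP] (i : I) : exists p, forall q, c q = i -> c p = i.
  have [[q qi]|H] := pselect (exists q, c q = i); first by exists q.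
  by exists 1 => q qi; case: H; exists q.
apply: (@sub_finite_set _ _ [set outer (conj_hom (s i)) | i in [set: I]]).
  move=> _ /range_mod_InnP[p <-]; exists (c p) => //.
  apply/esym/outer_conj_hom_eq/nG.
  have := @same_orbit_action_conj _ n p^-1 (val p) (val (s (c p))).
  rewrite -[_ * val p]/(val (p^-1 * p)) mulVg; apply; apply: cP.
  by apply/esym/(sP _ p).
exact/finite_image/finite_finset.
Qed.

End FiniteSignature.

(** * Discreteness from a finite open subgroup, and the theorem *)

Lemma topological_group_mull (T : groupTopType) (x : T) :
  topological_group T -> continuous (fun y => x * y).
Proof.
case=> cM _ y U /(cM (x, y))[[V W] [/= nV nW] VW].
by apply: filterS nW => z Wz; apply: (VW (x, z)); split=> //; exact: nbhs_singleton.
Qed.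

(** The finitely many nontrivial elements of [H] form a closed set, so the singleton of 1 is open,
    and so are its translates. *)
Lemma finite_open_subgroup_discrete (T : groupTopType) (H : subgroup T) :
  topological_group T -> accessible_space T -> open (H : set T) ->
  finite_set (H : set T) -> discrete_space T.
Proof.
move=> tgT acT oH finH.
have o1 : open [set (1 : T)].
  rewrite (_ : [set _] = (H : set T) `&` ~` ((H : set T) `\` [set 1])).
    apply: openI => //; rewrite openC.
    by move/accessible_finite_set_closed: acT; apply; exact: finite_setD.
  apply/seteqP; split=> [_ ->|x [Hx nx]]; first by split; [exact: subgroup1|case=> _; exact].
  by apply: contrapT => x1; apply: nx.
move=> A; rewrite (_ : A = \bigcup_(x in A) [set y | x^-1 * y = 1]).
  apply: bigcup_open => x _.
  by move/continuousP: (@topological_group_mull _ x^-1 tgT) => /(_ _ o1).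
apply/seteqP; split=> [x Ax|y [x Ax /= xy]]; first by exists x => //=; exact: mulVg.
by rewrite -[y](mulVKg x) xy mulg1.
Qed.

Theorem theorem3p12 (G : closed_subgroup) (G_oligomorphic : oligomorphic G) :
  open (range (@conj_hom G)) /\
  [/\ totally_disconnected [set: Out G],
      locally_compact [set: Out G],
      open (range_mod_Inn G : set (Out G)),
      profinite (set_type (range_mod_Inn G))
    & forall (L : signature) (M : structure L nat),
        finite_signature L -> interdefinable (canonical_structure G) M ->
        finite_set (range_mod_Inn G : set (Out G)) /\ discrete_space (Out G)].
Proof.
have olG := G_oligomorphic.
have tgO := linear_basis1_topological_group (@Out_linear_basis1 G).
have zdO := Out_zero_dimensional olG.
have hO := zero_dimensional_hausdorff zdO.
have oP := open_range_mod_Inn olG.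
have cP := compact_range_mod_Inn olG.
have cval : continuous (val : set_type (range_mod_Inn G) -> Out G).
  exact: initial_continuous.
have zdP : zero_dimensional (set_type (range_mod_Inn G)).
  move=> x y xy; have [|U [cU Ux Uy]] := zdO (val x) (val y); first by [].
  by exists (val @^-1` U); split=> //; exact: preimage_clopen.
split; first exact: open_range_conj_hom.
split=> //.
- exact: zero_dimension_totally_disconnected.
- move=> x _.
  have cMl (y : Out G) := @topological_group_mull _ y tgO.
  (* The translate by [x] of the compact open subgroup is a compact neighbourhood of [x], closed as
     Out(G) is Hausdorff. *)
  have cxP : compact [set x * val z | z in [set: set_type (range_mod_Inn G)]].
    apply: continuous_compact => //; apply: continuous_subspaceT => z.
    exact: continuous_comp (cval z) (cMl x _).
  exists [set x * val z | z in [set: set_type (range_mod_Inn G)]].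
    have nP : nbhs (x^-1 * x)%g (range_mod_Inn G : set (Out G)).
      by apply: open_nbhs_nbhs; split=> //; rewrite mulVg; exact: subgroup1.
    apply: (@filterS _ (nbhs x) _ _ _ _ (cMl x^-1%g x _ nP)) => y Py _.
    by exists (exist _ (x^-1 * y)%g (mem_set Py)) => //; exact: mulVKg.
  by split=> //; exact: compact_closed.
- split=> //.
  + exact: topological_group_subgroup.
  + exact: zero_dimensional_hausdorff.
  + exact: zero_dimension_totally_disconnected.
move=> L M finL GM.
have [n nG] := finite_signature_orbits finL GM.
have finP := finite_range_mod_Inn olG nG.
split=> //; apply: (finite_open_subgroup_discrete tgO _ oP) => //.
exact: hausdorff_accessible.
Qed.
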